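(* Let $D_1$ be a bounded convex balanced domain in $\mathbb{C}^n$ whose holomorphic automorphism group $\mathrm{Aut}(D_1)$ is noncompact, and let $p\in\partial D_1$ be a boundary orbit-accumulation point. Let $D_2$ be a realization of a bounded symmetric domain as a bounded convex balanced domain in $\mathbb{C}^n$. Assume that there is a neighbourhood $U$ of $p$ in $\mathbb{C}^n$ and a holomorphic map $F:U\to\mathbb{C}^n$ that is biholomorphic onto its image such that $F(U\cap D_1)\subset D_2$ and $F(U\cap\partial D_1)\subset\partial D_2$. Assume that either $p$ is a peak point (of $D_1$) or $F(p)$ is a peak point (of $D_2$). Then there exists a linear map that maps $D_1$ biholomorphically onto $D_2$.
   Context: A domain $D\subset\mathbb{C}^n$ is balanced if, for every $z\in D$, $\zeta z\in D$ for each $\zeta\in\mathbb{C}$ with $|\zeta|\le 1$. $\mathrm{Aut}(D)$ denotes the group of holomorphic automorphisms of $D$ with the compact-open topology. For a domain $D\subset\mathbb{C}^n$ with $D\neq\mathbb{C}^n$ and $p\in\partial D$: $p$ is a boundary orbit-accumulation point if there exist a point $a\in D$ and a sequence $\{\phi_k\}\subset \mathrm{Aut}(D)$ such that $\lim_{k\to\infty}\phi_k(a)=p$; $p$ is a peak point (of $D$) if there exists a function $h$ that is holomorphic on $D$ and continuous on $\overline{D}$, with $h(p)=1$ and $|h(z)|<1$ for all $z\in\overline{D}\setminus\{p\}$. A bounded symmetric domain is a bounded domain in $\mathbb{C}^n$ that is a holomorphic imbedding in $\mathbb{C}^n$ of a Hermitian symmetric space of noncompact type. Every bounded symmetric domain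 is biholomorphic to a bounded convex balanced domain in $\mathbb{C}^n$, unique up to a linear isomorphism of $\mathbb{C}^n$ (Harish-Chandra realization); ''realization as a bounded convex balanced domain'' refers to this. *)

(* Defs.v *)
From HB Require Import structures.
From mathcomp Require Import all_boot all_order all_algebra.
From mathcomp Require Import complex.
From mathcomp Require Import all_classical all_reals all_analysis.
Set Implicit Arguments.
Unset Strict Implicit.
Unset Printing Implicit Defensive.
Import Order.TTheory GRing.Theory Num.Theory.
Import numFieldNormedType.Exports.

Local Open Scope classical_set_scope.
Local Open Scope ring_scope.

(* MathComp-Analysis puts the modulus topology on the regular module K^o of a
   numFieldType K; this transfers it to the carrier R[i] itself. *)
HB.instance Definition _ (R : realType) := NormedModule.copy R[i] R[i]^o.

Section Domains.
Variables (R : realType) (n : nat).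
Local Notation Cn := 'rV[R[i]]_n.
Implicit Types (D E U : set Cn) (p : Cn).

Definition domain D : Prop := [/\ open D, connected D & D !=set0].

Definition balanced D : Prop :=
  forall z : Cn, D z -> forall zeta : R[i], `|zeta| <= 1 -> D (zeta *: z).

(* In convex_set the weights range over t : R[i] with 0 <= t <= 1; in the
   partial order of R[i] these are exactly the real numbers in [0, 1]. *)
Definition bounded_convex_balanced_domain D : Prop :=
  [/\ domain D, bounded_set D, convex_set D & balanced D].

Definition boundary D : set Cn := closure D `\` interior D.

(* [differentiable] is Frechet differentiability over the scalar field R[i], so
   on an open set this is holomorphy. Values of f off D play no role. *)
Definition holomorphic_on (W : normedModType R[i]) D (f : Cn -> W) : Prop :=
  open D /\ forall z, D z -> differentiable f z.

Definition biholomorphic D E (f : Cn -> Cn) : Prop :=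
  [/\ holomorphic_on D f, f @` D = E &
      exists g : Cn -> Cn,
        holomorphic_on E g /\ forall z, D z -> g (f z) = z].

(* Automorphisms are maps of the subtype D to itself, so that Aut D sits in the
   function space D -> D with its compact-open topology. *)
Definition Aut D : set {compact-open, D -> D} :=
  [set phi | exists f : Cn -> Cn,
     biholomorphic D D f /\ forall z : D, set_val (phi z) = f (set_val z)].

Definition boundary_orbit_accumulation_point D p : Prop :=
  boundary D p /\
  exists (a : D) (phi : nat -> {compact-open, D -> D}),
    (forall k, Aut (phi k)) /\ (set_val (phi k a) @[k --> \oo] --> p).

Definition peak_point D p : Prop :=
  boundary D p /\
  exists h : Cn -> R[i],
    [/\ holomorphic_on D h, {within closure D, continuous h}, h p = 1 &
        forall z, closure D z -> z <> p -> `|h z| < 1].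

End Domains.

Arguments Aut {R n} D.

Section HermitianSymmetricSpaces.
Variables (R : realType) (n : nat).
Local Notation Cn := 'rV[R[i]]_n.
Implicit Types (D B : set Cn) (g : Cn -> 'M[R[i]]_n).

(* f is of class C^k on the open set D in the real sense: iterated directional
   derivatives, for real increments in all 2n real directions, up to order k
   exist and are continuous. *)
Fixpoint real_Ck (k : nat) D (f : Cn -> R[i]) : Prop :=
  {within D, continuous f} /\
  if k is k'.+1 then
    forall v : Cn, exists f' : Cn -> R[i],
      (forall z, D z ->
         (r%:C%C)^-1 * (f (z + r%:C%C *: v) - f z) @[r --> (0 : R)^'] --> f' z)
      /\ real_Ck k' D f'
  else True.

Definition real_smooth D (f : Cn -> R[i]) : Prop := forall k, real_Ck k D f.

Definition herm (A : 'M[R[i]]_n) (u v : Cn) : R[i] :=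
  (u *m A *m (map_mx Num.conj v)^T) 0 0.

Definition hermitian_metric D g : Prop :=
  [/\ forall i j, real_smooth D (fun z => g z i j),
      forall z, D z -> (map_mx Num.conj (g z))^T = g z &
      forall z, D z -> forall v, v != 0 -> 0 < herm (g z) v v].

Definition holomorphic_isometry D g (phi : Cn -> Cn) : Prop :=
  biholomorphic D D phi /\
  forall z, D z -> forall u v,
    herm (g (phi z)) ('d phi z u) ('d phi z v) = herm (g z) u v.

Definition symmetry_at D g (a : Cn) (s : Cn -> Cn) : Prop :=
  [/\ holomorphic_isometry D g s,
      forall z, D z -> s (s z) = z,
      s a = a &
      \forall z \near a, s z = z -> z = a].

(* Hermitian symmetric spaces whose underlying complex manifold is a domain of
   C^n. *)
Definition hermitian_symmetric_space D g : Prop :=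
  [/\ domain D, hermitian_metric D g &
      forall a, D a -> exists s, symmetry_at D g a s].

(* The Lie algebra of the group of holomorphic isometries of (D, g), realized
   by the vector fields on D that generate its one-parameter subgroups. *)
Definition infinitesimal_isometry D g (X : Cn -> Cn) : Prop :=
  exists phi : R -> Cn -> Cn,
    [/\ forall t, holomorphic_isometry D g (phi t),
        forall z, D z -> phi 0 z = z,
        forall s t z, D z -> phi (s + t) z = phi s (phi t z) &
        forall z, D z ->
          (r%:C%C)^-1 *: (phi r z - z) @[r --> (0 : R)^'] --> X z].

Definition lie_bracket (X Y : Cn -> Cn) (z : Cn) : Cn :=
  'd Y z (X z) - 'd X z (Y z).

Definition real_comb m (e : 'I_m -> Cn -> Cn) (x : 'rV[R]_m) (z : Cn) : Cn :=
  \sum_(i < m) (x 0 i)%:C%C *: e i z.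

(* e is a basis of the real Lie algebra of infinitesimal isometries, and row j
   of ad i lists the coordinates of the bracket of e i and e j. *)
Definition isometry_algebra_basis D g m (e : 'I_m -> Cn -> Cn)
    (ad : 'I_m -> 'M[R]_m) : Prop :=
  [/\ forall i, infinitesimal_isometry D g (e i),
      forall X, infinitesimal_isometry D g X ->
        exists x : 'rV[R]_m, forall z, D z -> X z = real_comb e x z,
      forall x : 'rV[R]_m, (forall z, D z -> real_comb e x z = 0) -> x = 0 &
      forall i j z, D z ->
        lie_bracket (e i) (e j) z = real_comb e (row j (ad i)) z].

Definition killing_form m (ad : 'I_m -> 'M[R]_m) (x y : 'rV[R]_m) : R :=
  \tr ((\sum_(i < m) x 0 i *: ad i) *m (\sum_(i < m) y 0 i *: ad i)).

(* The orthogonal symmetric Lie algebra of (D, g) is of noncompact type: the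
   splitting into the +1 and -1 eigenspaces of the involution induced by the
   symmetry at a base point o is a Cartan decomposition, that is, the Killing
   form is negative definite on the former and positive definite on the latter.
   (Semisimplicity is the resulting nondegeneracy of the Killing form.) The
   involution maps the vector field X to its push-forward ds (X o s). *)
Definition noncompact_type D g : Prop :=
  exists (m : nat) (e : 'I_m -> Cn -> Cn) (ad : 'I_m -> 'M[R]_m)
         (o : Cn) (s : Cn -> Cn),
    [/\ isometry_algebra_basis D g e ad,
        D o /\ symmetry_at D g o s,
        forall x : 'rV[R]_m, x != 0 ->
          (forall z, D z -> 'd s z (real_comb e x z) = real_comb e x (s z)) ->
          killing_form ad x x < 0 &
        forall x : 'rV[R]_m, x != 0 ->
          (forall z, D z -> 'd s z (real_comb e x z) = - real_comb e x (s z)) ->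
          0 < killing_form ad x x].

(* A holomorphic imbedding of a Hermitian symmetric space M onto B is the same
   thing as the metric g on B transported from M. *)
Definition bounded_symmetric_domain B : Prop :=
  bounded_set B /\
  exists g, hermitian_symmetric_space B g /\ noncompact_type B g.

Definition bounded_symmetric_domain_realization D : Prop :=
  bounded_convex_balanced_domain D /\
  exists B, bounded_symmetric_domain B /\ exists f, biholomorphic B D f.

End HermitianSymmetricSpaces.

(* Main.v *)
Require Import Defs.
From HB Require Import structures.
From mathcomp Require Import all_boot all_order all_algebra.
From mathcomp Require Import complex.
From mathcomp Require Import all_classical all_reals all_analysis.
From mathcomp Require Import ring lra.
Set Implicit Arguments.
Unset Strict Implicit.
Unset Printing Implicit Defensive.
Import Order.TTheory GRing.Theory Num.Theory.
Import numFieldNormedType.Exports.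
Local Open Scope classical_set_scope.
Local Open Scope ring_scope.

(* For every r < 1, an automorphism of D1 that moves a close enough to p maps
   all of r D1 close to p, because p is a local peak point; composing it with F
   and with an automorphism of D2 that brings the image of 0 back near 0 gives
   a map G from r D1 to D2, with an inverse H from r D2 to D1. By the Schwarz
   lemma (D2 is convex and balanced) dG(0) maps r D1 into the closure of D2,
   and dH(G(0)) maps almost all of r D2 into the closure of D1. A limit of
   these derivatives as r tends to 1 is a linear isomorphism of D1 onto D2;
   no limit of the maps G is needed.
   Peak points are used through Harnack's inequality: if |h| < 1 and 1 - h is
   small at one point, it is small nearby. Automorphisms of D2 bring any point
   close to 0 because the symmetry at x / 2 has derivative -1 there and so maps
   x to a point of size O(|x|^2). The estimates of complex analysis all come
   from one Schwarz lemma, proved by Goursat's bisection argument. *)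

(** Nothing says that [F] maps onto the part of [D2] near [F p], yet the inverse H has to pull all
    of [r D2] back into [D1]. The hypothesis on boundaries settles this: along a segment in [D2]
    near [F p], the local inverse of [F] cannot leave [D1], since it would have to cross the
    boundary of [D1], and [F] sends that into the boundary of [D2]. Attraction is needed at both
    ends, at [p] for the automorphisms of [D1] and at [F p] for those of [D2]. The peak hypothesis
    at one of the two points is therefore weakened to a local notion, which [F] or its inverse
    carries to the other point. Automorphisms of [D2] are only shown to bring points near 0, not to
    0, so the Schwarz lemma is needed for maps whose value at the centre is an arbitrary point of
    the convex balanced set. For each r the two derivatives are exactly inverse to each other,
    because H after G is the identity near 0; a bound on one family then keeps the limit of the
    other invertible. *)

(** * Real-valued norms over the complex numbers *)

Section RealNorm.
Variable R : realType.
Local Notation C := R[i].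

(* Norms over R[i] take values in R[i]; nr is the same norm with values in R. *)
Definition nr (V : normedModType C) (x : V) : R := complex.Re `|x|.

Section Generic.
Variable V : normedModType C.
Implicit Types x y : V.

Lemma nrE x : `|x| = (nr x)%:C%C.
Proof. by rewrite /nr (RRe_real (normr_real x)). Qed.

Lemma nr_ge0 x : 0 <= nr x.
Proof. by rewrite -(@lecR R) -nrE normr_ge0. Qed.

Lemma nr0 : nr (0 : V) = 0.
Proof. by rewrite /nr normr0. Qed.

Lemma nr_eq0 x : (nr x == 0) = (x == 0).
Proof. by rewrite -(normr_eq0 x) nrE eq_complex /= eqxx andbT. Qed.

Lemma nrN x : nr (- x) = nr x.
Proof. by rewrite /nr normrN. Qed.

Lemma nrBC x y : nr (x - y) = nr (y - x).
Proof. by rewrite -nrN opprB. Qed.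

Lemma nrD x y : nr (x + y) <= nr x + nr y.
Proof. by rewrite -(@lecR R) rmorphD/= -!nrE ler_normD. Qed.

Lemma nrB x y : nr (x - y) <= nr x + nr y.
Proof. by rewrite -(nrN y) nrD. Qed.

Lemma nr_tri x y z : nr (x - z) <= nr (x - y) + nr (y - z).
Proof. by rewrite -(subrKA y) nrD. Qed.

Lemma nrZ (k : C) x : nr (k *: x) = nr k * nr x.
Proof.
apply: (@complexI R); rewrite rmorphM/= -!nrE normrZ.
by [].
Qed.

Lemma near_nr (x : V) (P : set V) :
  (\forall y \near x, P y) <-> exists2 e : R, 0 < e & forall y, nr (y - x) < e -> P y.
Proof.
split.
  (* In the order of [R[i]], [0 < e] forces [e] to be real. *)
  move=> /nbhs_ballP[e/= e0 eP]; move: (e0); rewrite ltcE/= => /andP[/eqP e1 e2].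
  exists (complex.Re e) => // y yx; apply: eP.
  by rewrite -ball_normE/= distrC nrE ltcE/= yx e1 eqxx.
move=> [e e0 eP]; apply/nbhs_ballP; exists e%:C%C => /=; first by rewrite ltcR.
by move=> y; rewrite -ball_normE/= distrC nrE ltcR => /eP.
Qed.

Lemma open_nr (D : set V) :
  open D <-> forall x, D x -> exists2 e : R, 0 < e & forall y, nr (y - x) < e -> D y.
Proof.
rewrite openE; split.
  by move=> oD x /oD; rewrite /interior => /near_nr.
by move=> h x /h; rewrite /interior => /near_nr.
Qed.

Lemma closure_nr (D : set V) x :
  closure D x <-> forall e : R, 0 < e -> exists2 y, D y & nr (y - x) < e.
Proof.
split.
  move=> cl e e0; have [|y [Dy yx]] := cl [set y | nr (y - x) < e].
    by apply/near_nr; exists e.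
  by exists y.
move=> h B /near_nr[e e0 eB]; have [y Dy /eB By] := h _ e0.
by exists y.
Qed.

End Generic.

Lemma nr_def (z : C) : nr z = Num.sqrt (complex.Re z ^+ 2 + complex.Im z ^+ 2).
Proof. by rewrite /nr normc_def. Qed.

Lemma nrM (a b : C) : nr (a * b) = nr a * nr b.
Proof. exact: (nrZ a b). Qed.

Lemma nr1 : nr (1 : C) = 1.
Proof. by rewrite /nr normr1. Qed.

Lemma nrV (a : C) : nr a^-1 = (nr a)^-1.
Proof.
have [->|a0] := eqVneq a 0; first by rewrite invr0 nr0 invr0.
have na0 : nr a != 0 by rewrite nr_eq0.
by apply: (mulfI na0); rewrite -nrM mulfV// nr1 mulfV.
Qed.

Lemma nr_real (r : R) : nr (r%:C%C) = `|r|.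
Proof. by rewrite nr_def/= expr0n addr0 sqrtr_sqr. Qed.

Lemma nr_nat k : nr (k%:R : C) = k%:R.
Proof. by rewrite -(rmorph_nat (@real_complex R)) nr_real ger0_norm. Qed.

Lemma nr_Re (z : C) : `|complex.Re z| <= nr z.
Proof. by rewrite nr_def -sqrtr_sqr ler_wsqrtr// lerDl sqr_ge0. Qed.

Lemma nr_Im (z : C) : `|complex.Im z| <= nr z.
Proof. by rewrite nr_def -sqrtr_sqr ler_wsqrtr// lerDr sqr_ge0. Qed.

Lemma nr_le_ReIm (z : C) : nr z <= `|complex.Re z| + `|complex.Im z|.
Proof.
rewrite nr_def -[leRHS]ger0_norm ?addr_ge0// -sqrtr_sqr ler_wsqrtr//.
rewrite sqrrD !real_normK ?num_real// -addrA lerD2l lerDr mulrn_wge0//.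
Qed.

Lemma nr_entry m n (x : 'M[C]_(m, n)) i j : nr (x i j) <= nr x.
Proof.
rewrite -(@lecR R) -!nrE; have -> : x i j = x (i, j).1 (i, j).2 by [].
by rewrite -[leLHS]nngE [X in _ <= X]/(mx_norm x) num_le; exact: le_bigmax.
Qed.

Lemma nr_matrix_le m n (x : 'M[C]_(m, n)) (M : R) :
  0 <= M -> (forall i j, nr (x i j) <= M) -> nr x <= M.
Proof.
move=> M0 xM; have [->|x0] := eqVneq x 0; first by rewrite nr0.
have [|ij xij] := @mx_norm_neq0 _ _ _ x; first by apply: contra_neq x0 => /mx_norm_eq0.
by rewrite /nr [X in complex.Re X]xij xM.
Qed.

End RealNorm.

(** * Bisection of rectangles and intervals *)

Section Bisection.
Variable R : realType.

Lemma half_pow_lt (e : R) : 0 < e -> exists k0, forall k, (k0 <= k)%N -> 2^-1 ^+ k < e.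
Proof.
move=> e0; have := @cvg_expr R 2^-1; rewrite ger0_norm//.
move=> /(_ ltac:(lra))/cvgrPdist_lt/(_ _ e0)[k0 _ k0P]; exists k0 => k /k0P /=.
by rewrite sub0r normrN ger0_norm ?exprn_ge0.
Qed.

(** If [P] failed on the whole rectangle, [merge] would give a failing quarter, then a failing
    quarter of that, and so on; the nested rectangles shrink to a point, where [loc] contradicts the
    failure. A rectangle is given by its lower left corner and its scale [t], its sides being
    [w * t] and [h * t]. Either side may be 0, which yields the one-dimensional version. *)
Lemma bisection_square (P : R -> R -> R -> Prop) (x0 y0 w h : R) :
  0 <= w -> 0 <= h ->
  let inside x y t := [/\ x0 <= x, x + w * t <= x0 + w, y0 <= y & y + h * t <= y0 + h] in
  (forall x y t, 0 < t -> inside x y t ->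
     P x y (t / 2) -> P (x + w * (t / 2)) y (t / 2) ->
     P x (y + h * (t / 2)) (t / 2) ->
     P (x + w * (t / 2)) (y + h * (t / 2)) (t / 2) -> P x y t) ->
  (forall a b, x0 <= a <= x0 + w -> y0 <= b <= y0 + h ->
     exists2 d, 0 < d & forall x y t, 0 < t < d -> inside x y t ->
       x <= a <= x + w * t -> y <= b <= y + h * t -> P x y t) ->
  P x0 y0 1.
Proof.
move=> w0 h0 inside merge loc; apply: contrapT => nP.
pose tk (k : nat) : R := 2^-1 ^+ k.
have tk0 k : 0 < tk k by rewrite exprn_gt0.
have tkS k : tk k.+1 = tk k / 2 by rewrite /tk exprSr.
pose bad k (p : R * R) := inside p.1 p.2 (tk k) /\ ~ P p.1 p.2 (tk k).
pose child k (p q : R * R) := [/\ bad k.+1 q, p.1 <= q.1, p.2 <= q.2,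
   q.1 + w * tk k.+1 <= p.1 + w * tk k & q.2 + h * tk k.+1 <= p.2 + h * tk k].
(* The implication stands under the [exists] so that choice yields a total function [next]. *)
have step k p : exists q, bad k p -> child k p q.
  have [bp|] := pselect (bad k p); last by exists p.
  have [[i1 i2 i3 i4] np] := bp.
  apply: contrapT => /forallNP no; apply: np; have t0 := tk0 k.
  have wt : 0 <= w * (tk k / 2) by rewrite mulr_ge0// divr_ge0// ltW.
  have ht : 0 <= h * (tk k / 2) by rewrite mulr_ge0// divr_ge0// ltW.
  have wt2 : w * tk k = w * (tk k / 2) + w * (tk k / 2) by field.
  have ht2 : h * tk k = h * (tk k / 2) + h * (tk k / 2) by field.
  apply: merge => //; apply: contrapT => nP'.
  - apply: (no (p.1, p.2)) => _; split; rewrite ?tkS //=; try lra.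
    by split; rewrite ?tkS//=; split => //; lra.
  - apply: (no (p.1 + w * (tk k / 2), p.2)) => _; split; rewrite ?tkS //=; try lra.
    by split; rewrite ?tkS//=; split => //; lra.
  - apply: (no (p.1, p.2 + h * (tk k / 2))) => _; split; rewrite ?tkS //=; try lra.
    by split; rewrite ?tkS//=; split => //; lra.
  - apply: (no (p.1 + w * (tk k / 2), p.2 + h * (tk k / 2))) => _; split; rewrite ?tkS //=; try lra.
    by split; rewrite ?tkS//=; split => //; lra.
pose next k p := projT1 (cid (step k p)).
have nextP k p : bad k p -> child k p (next k p) by rewrite /next; case: cid.
pose u := fix u k := if k is k'.+1 then next k' (u k') else (x0, y0).
have ub k : bad k (u k).
  elim: k => [|k IH] /=; last by have [] := nextP _ _ IH.
  by split; rewrite /tk expr0 //=; split; rewrite ?mulr1.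
have uc k : child k (u k) (u k.+1) by apply: nextP.
have ule j k : (j <= k)%N -> [/\ (u j).1 <= (u k).1, (u j).2 <= (u k).2,
    (u k).1 + w * tk k <= (u j).1 + w * tk j & (u k).2 + h * tk k <= (u j).2 + h * tk j].
  move=> /subnK <-; elim: (k - j)%N => [|m [a1 a2 a3 a4]]; first by rewrite add0n.
  by have [_ b1 b2 b3 b4] := uc (m + j)%N; rewrite addSn; split; lra.
have tw k : 0 <= w * tk k by rewrite mulr_ge0// ltW.
have th k : 0 <= h * tk k by rewrite mulr_ge0// ltW.
pose A := [set (u k).1 | k in [set: nat]]; pose B := [set (u k).2 | k in [set: nat]].
have upA k x : A x -> x <= (u k).1 + w * tk k.
  move=> [j _ <-]; have [/ule[a1 a2 a3 a4]|/ltnW/ule[a1 a2 a3 a4]] := leqP j k.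
    by have := tw k; lra.
  by have := tw j; lra.
have upB k x : B x -> x <= (u k).2 + h * tk k.
  move=> [j _ <-]; have [/ule[a1 a2 a3 a4]|/ltnW/ule[a1 a2 a3 a4]] := leqP j k.
    by have := th k; lra.
  by have := th j; lra.
have A0 : A !=set0 by exists (u 0%N).1, 0%N.
have B0 : B !=set0 by exists (u 0%N).2, 0%N.
(* Lower left corners increase and upper right corners decrease, so the suprema of the lower left
   coordinates give a point common to all the rectangles. *)
have supA k : (u k).1 <= sup A <= (u k).1 + w * tk k.
  rewrite ge_sup//=; try by move=> x /(upA k).
  rewrite andbT; apply: ub_le_sup; last by exists k.
  by exists ((u k).1 + w * tk k) => x; apply: upA.
have supB k : (u k).2 <= sup B <= (u k).2 + h * tk k.
  rewrite ge_sup//=; try by move=> x /(upB k).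
  rewrite andbT; apply: ub_le_sup; last by exists k.
  by exists ((u k).2 + h * tk k) => x; apply: upB.
have [||d d0 dP] := loc (sup A) (sup B).
- by have := supA 0%N; rewrite /tk expr0 mulr1.
- by have := supB 0%N; rewrite /tk expr0 mulr1.
have [k /(_ k (leqnn k)) kd] := half_pow_lt d0.
have [ik nPk] := ub k; apply: nPk; apply: dP => //; first by rewrite tk0.
Qed.

(** The case of a rectangle of height 0. Besides Goursat's theorem, this replaces compactness and
    connectedness of intervals throughout: means, the mean value inequality and a path that cannot
    leave a domain. *)
Lemma bisection (Q : R -> R -> Prop) (a b : R) : a <= b ->
  (forall x z, a <= x -> x <= z -> z <= b -> Q x ((x + z) / 2) -> Q ((x + z) / 2) z ->
     Q x z) ->
  (forall c, a <= c <= b -> exists2 d, 0 < d &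
     forall x z, a <= x <= c -> c <= z <= b -> z - x < d -> Q x z) ->
  Q a b.
Proof.
move=> ab merge loc.
have := @bisection_square (fun x _ t => Q x (x + (b - a) * t)) a 0 (b - a) 0.
have -> : a + (b - a) * 1 = b by ring.
apply; rewrite ?subr_ge0//.
  move=> x y t t0 [x1 x2 _ _] q1 q2 _ _.
  have wt : 0 <= (b - a) * t by rewrite mulr_ge0 ?subr_ge0// ltW.
  have e : (x + (x + (b - a) * t)) / 2 = x + (b - a) * (t / 2) by field.
  apply: merge; rewrite ?e//; try lra.
  by move: q2; congr Q; field.
move=> c b0 cab b00; have [|d d0 dP] := loc c; first by move: cab; lra.
have w1 : 0 < b - a + 1 by lra.
exists (d / (b - a + 1)); first by rewrite divr_gt0.
move=> x y t /andP[t0]; rewrite ltr_pdivlMr// => td [x1 x2 _ _] xc yc.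
apply: dP; try lra.
Qed.

End Bisection.

(** * Integrals of complex-valued functions over an interval *)

Section ComplexIntegral.
Variable R : realType.
Local Notation C := R[i].
Local Notation mu := (@lebesgue_measure R).
Implicit Types (f g : R -> C) (a b c : R).

(** The point [y] is not confined to [[a, b]], so continuity at the end points is two-sided. *)
Definition continuous_on (V : normedModType C) (f : R -> V) a b := forall x, a <= x <= b -> forall e, 0 < e ->
  exists2 d, 0 < d & forall y, `|y - x| < d -> nr (f y - f x) < e.

Definition cintegral f a b : C :=
  (\int[mu]_(x in `[a, b]) complex.Re (f x) +i* \int[mu]_(x in `[a, b]) complex.Im (f x))%C.

Lemma continuous_on_cst (k : C) a b : continuous_on (fun=> k) a b.
Proof. by move=> x _ e e0; exists 1 => // y _; rewrite subrr nr0. Qed.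

Lemma continuous_onB f g a b :
  continuous_on f a b -> continuous_on g a b -> continuous_on (fun x => f x - g x) a b.
Proof.
move=> cf cg x xab e e0; have e2 : 0 < e / 2 by rewrite divr_gt0.
have [d d0 fd] := cf x xab _ e2; have [d' d'0 gd] := cg x xab _ e2.
exists (Num.min d d') => [|y]; first by rewrite lt_min d0.
rewrite lt_min => /andP[/fd h1 /gd h2].
rewrite (_ : _ - _ = (f y - f x) - (g y - g x)); last by ring.
by apply: (le_lt_trans (nrB _ _)); lra.
Qed.

Lemma continuous_on_lip f a b (K : R) :
  (forall x y, nr (f y - f x) <= K * `|y - x|) -> continuous_on f a b.
Proof.
move=> fK x _ e e0; have K1 : 0 < `|K| + 1 by rewrite ltr_wpDl.
exists (e / (`|K| + 1)) => [|y]; first by rewrite divr_gt0.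
rewrite ltr_pdivlMr// => h; apply: le_lt_trans (fK x y) _; apply: le_lt_trans h.
by rewrite mulrC ler_wpM2l//; have := ler_norm K; lra.
Qed.

Lemma continuous_on_within f (p : C -> R) a b :
  (forall z w, `|p z - p w| <= nr (z - w)) -> continuous_on f a b ->
  {within `[a, b], continuous (p \o f)}.
Proof.
move=> pl cf; apply: continuous_in_subspaceT => x; rewrite inE/= in_itv/= => xab.
apply/cvgrPdist_lt => e e0; have [d d0 fd] := cf _ xab _ e0.
exists d => //= y /=; rewrite distrC => /fd h; rewrite distrC.
exact: le_lt_trans (pl _ _) h.
Qed.

Lemma Re_lip (z w : C) : `|complex.Re z - complex.Re w| <= nr (z - w).
Proof. by rewrite -raddfB; exact: nr_Re. Qed.

Lemma Im_lip (z w : C) : `|complex.Im z - complex.Im w| <= nr (z - w).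
Proof. by rewrite -raddfB; exact: nr_Im. Qed.

Lemma continuous_on_integrable f (p : C -> R) a b :
  (forall z w, `|p z - p w| <= nr (z - w)) -> continuous_on f a b ->
  mu.-integrable `[a, b] (EFin \o (p \o f)).
Proof.
move=> pl cf; apply: continuous_compact_integrable; first exact: segment_compact.
exact: continuous_on_within.
Qed.

Let iRe f a b cf := @continuous_on_integrable f _ a b Re_lip cf.
Let iIm f a b cf := @continuous_on_integrable f _ a b Im_lip cf.

Lemma cintegralB f g a b : continuous_on f a b -> continuous_on g a b ->
  cintegral (fun x => f x - g x) a b = cintegral f a b - cintegral g a b.
Proof.
move=> cf cg; rewrite /cintegral.
under eq_Rintegral => x _ do rewrite raddfB.
under [X in (_ +i* X)%C]eq_Rintegral => x _ do rewrite raddfB.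
rewrite (RintegralB _ (iRe cf) (iRe cg))//.
by rewrite (RintegralB _ (iIm cf) (iIm cg)).
Qed.

Lemma eq_cintegral f g a b : (forall x, a <= x <= b -> f x = g x) ->
  cintegral f a b = cintegral g a b.
Proof.
move=> fg; congr (_ +i* _)%C; apply: eq_Rintegral => x;
  by rewrite inE/= in_itv/= => /fg ->.
Qed.

Lemma cintegral_cat f a b c : a <= b -> b <= c -> continuous_on f a c ->
  cintegral f a c = cintegral f a b + cintegral f b c.
Proof.
move=> ab bc cf.
have key (p : C -> R) : (forall z w, `|p z - p w| <= nr (z - w)) ->
   \int[mu]_(x in `[a, c]) p (f x) =
   \int[mu]_(x in `[a, b]) p (f x) + \int[mu]_(x in `[b, c]) p (f x).
  move=> pl; have ip := continuous_on_integrable pl cf.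
  rewrite -[LHS](subrK (\int[mu]_(x in `[a, b]) p (f x))) addrC; congr (_ + _).
  rewrite Rintegral_itvB ?bnd_simp//; apply: Rintegral_itv_obnd_cbnd.
  apply: integrableS ip => //; apply: subset_itv; rewrite ?bnd_simp//.
by rewrite /cintegral (key _ Re_lip) (key _ Im_lip).
Qed.

(** The factor 2 comes from bounding the real and imaginary parts separately. It does no harm, since
    only error terms that are made arbitrarily small are estimated this way. *)
Lemma nr_cintegral_le f a b (M : R) : a <= b -> continuous_on f a b ->
  (forall x, a <= x <= b -> nr (f x) <= M) -> nr (cintegral f a b) <= 2 * M * (b - a).
Proof.
move=> ab cf fM.
have key (p : C -> R) : (forall z w, `|p z - p w| <= nr (z - w)) ->
   (forall z, `|p z| <= nr z) -> `|\int[mu]_(x in `[a, b]) p (f x)| <= M * (b - a).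
  move=> pl pn; have ip := continuous_on_integrable pl cf.
  apply: (le_trans (le_normr_Rintegral _ ip)) => //.
  have -> : M * (b - a) = \int[mu]_(x in `[a, b]) M.
    rewrite Rintegral_cst//= lebesgue_measure_itv/= lte_fin.
    by move: ab; rewrite le_eqVlt => /orP[/eqP ->|->//]; rewrite ltxx subrr.
  apply: le_Rintegral => //.
  - by have := integrable_norm ip; apply: eq_integrable.
  - apply: continuous_compact_integrable; first exact: segment_compact.
    by move=> x; exact: cvg_cst.
  - by move=> x /=; rewrite in_itv/= => /fM; apply: le_trans.
rewrite (le_trans (nr_le_ReIm _))//= -mulrA mulr_natl mulr2n.
by rewrite lerD// ?(key _ Re_lip (@nr_Re R))// ?(key _ Im_lip (@nr_Im R)).
Qed.

Lemma cintegral_affine (k l : C) a b : a <= b ->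
  cintegral (fun x => k + l * x%:C%C) a b = k * (b - a)%:C%C + l * ((b ^+ 2 - a ^+ 2) / 2)%:C%C.
Proof.
move=> ab.
have key (u v : R) : \int[mu]_(x in `[a, b]) (u + v * x) = u * (b - a) + v * ((b ^+ 2 - a ^+ 2) / 2).
  move: ab; rewrite le_eqVlt => /orP[/eqP<-|ab].
    by rewrite set_itv1 Rintegral_set1 !subrr; ring.
  pose F : R -> R := u *: id + (v / 2) *: id ^+ 2.
  have FE x : F x = u * x + v / 2 * x ^+ 2 by [].
  have dF (x : R) : is_derive x 1 F (u + v * x).
    have d2 := is_deriveX 2 (is_derive_id x (1 : R)).
    have := is_deriveD (is_deriveZ u (is_derive_id x (1 : R))) (is_deriveZ (v / 2) d2).
    congr (is_derive _ _ _ _); rewrite /= expr1 /GRing.scale/=.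
    by field.
  rewrite /Rintegral (@continuous_FTC2 _ _ F)//=.
  - by rewrite !FE; field.
  - apply: continuous_subspaceT => x; apply: cvgD; first exact: cvg_cst.
    by apply: cvgM; [exact: cvg_cst|exact: cvg_id].
  - have cF x : {for x, continuous F}.
      by apply/differentiable_continuous/derivable1_diffP; exact: ex_derive.
    split; [by move=> x _; exact: ex_derive| |].
      exact/cvg_at_right_filter/cF.
    exact/cvg_at_left_filter/cF.
  - by move=> x _; rewrite derive1E derive_val.
have eRe : \int[mu]_(x in `[a, b]) complex.Re (k + l * x%:C%C) =
    \int[mu]_(x in `[a, b]) (complex.Re k + complex.Re l * x).
  by apply: eq_Rintegral => x _; case: k l => k1 k2 [l1 l2] /=; ring.
have eIm : \int[mu]_(x in `[a, b]) complex.Im (k + l * x%:C%C) =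
    \int[mu]_(x in `[a, b]) (complex.Im k + complex.Im l * x).
  by apply: eq_Rintegral => x _; clear; case: k l => k1 k2 [l1 l2] /=; ring.
rewrite /cintegral eRe eIm !key; move: k l {eRe eIm} => [k1 k2] [l1 l2].
by apply/eqP; rewrite eq_complex/=; apply/andP; split; apply/eqP; ring.
Qed.

End ComplexIntegral.

(** * Goursat's theorem and the Schwarz lemma *)

Section Goursat.
Variable R : realType.
Local Notation C := R[i].
Implicit Types (G : R -> R -> C) (x y w h : R).

(* Complex differentiability at x + i y of a function of the two real
   coordinates. *)
Definition cdiff_at G x y := exists d : C, forall e : R, 0 < e ->
  exists2 r, 0 < r & forall a b : R, `|a| < r -> `|b| < r ->
    nr (G (x + a) (y + b) - G x y - d * (a +i* b)%C) <= e * (`|a| + `|b|).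

(** The counterclockwise contour integral along the sides of the rectangle: bottom, right, top,
    left, with dz = i dt on the vertical sides. *)
Definition rectangle_integral G x y w h : C :=
  cintegral (G ^~ y) x (x + w) + 'i%C * cintegral (G (x + w)) y (y + h)
  - cintegral (G ^~ (y + h)) x (x + w) - 'i%C * cintegral (G x) y (y + h).

Lemma cdiff_at_continuous G x y : cdiff_at G x y -> forall e, 0 < e ->
  exists2 r, 0 < r & forall a b : R, `|a| < r -> `|b| < r ->
    nr (G (x + a) (y + b) - G x y) < e.
Proof.
move=> [d dP] e e0; have [r r0 rP] := dP 1 ltr01.
have n1 : 0 < nr d + 1 by rewrite ltr_wpDl ?nr_ge0.
exists (Num.min r (e / (nr d + 1) / 2)) => [|a b].
  by rewrite lt_min r0 !divr_gt0.
rewrite !lt_min => /andP[ar a1] /andP[br b1].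
have := rP _ _ ar br; rewrite mul1r => h.
have ab : `|a| + `|b| < e / (nr d + 1) by lra.
have n2 : nr (a +i* b)%C <= `|a| + `|b| by exact: nr_le_ReIm.
rewrite -[_ - _](subrK (d * (a +i* b)%C)).
apply: le_lt_trans (nrD _ _) _; rewrite nrM.
move: ab; rewrite ltr_pdivlMr//; apply: le_lt_trans.
by rewrite mulrDr mulr1 addrC lerD// mulrC ler_wpM2r ?nr_ge0.
Qed.

Lemma cdiff_at_row G a b y : (forall x, a <= x <= b -> cdiff_at G x y) ->
  continuous_on (G ^~ y) a b.
Proof.
move=> dG x xab e e0; have [r r0 rP] := cdiff_at_continuous (dG x xab) e0.
exists r => // z zx; have := rP (z - x) 0 zx; rewrite normr0 => /(_ r0).
by rewrite addr0 (addrC x) subrK.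
Qed.

Lemma cdiff_at_col G a b x : (forall y, a <= y <= b -> cdiff_at G x y) ->
  continuous_on (G x) a b.
Proof.
move=> dG y yab e e0; have [r r0 rP] := cdiff_at_continuous (dG y yab) e0.
exists r => // z zx; have := rP 0 (z - y); rewrite normr0 => /(_ r0 zx).
by rewrite addr0 (addrC y) subrK.
Qed.

(** A side shared by two quarters is traversed once in each direction and cancels. *)
Lemma rectangle_integral_split G x y (u v : R) : 0 <= u -> 0 <= v ->
  (forall a b, x <= a <= x + u + u -> y <= b <= y + v + v -> cdiff_at G a b) ->
  rectangle_integral G x y (u + u) (v + v) =
  rectangle_integral G x y u v + rectangle_integral G (x + u) y u v +
  rectangle_integral G x (y + v) u v + rectangle_integral G (x + u) (y + v) u v.
Proof.
move=> u0 v0 dG.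
have hor b : y <= b <= y + v + v -> cintegral (G ^~ b) x (x + u + u) =
    cintegral (G ^~ b) x (x + u) + cintegral (G ^~ b) (x + u) (x + u + u).
  move=> yb; apply: cintegral_cat; rewrite ?lerDl//.
  by apply: cdiff_at_row => a xa; apply: dG.
have ver a : x <= a <= x + u + u -> cintegral (G a) y (y + v + v) =
    cintegral (G a) y (y + v) + cintegral (G a) (y + v) (y + v + v).
  move=> xa; apply: cintegral_cat; rewrite ?lerDl//.
  by apply: cdiff_at_col => b yb; apply: dG.
have y1 : y <= y <= y + v + v by lra.
have y2 : y <= y + v + v <= y + v + v by lra.
have x1 : x <= x <= x + u + u by lra.
have x2 : x <= x + u + u <= x + u + u by lra.
rewrite /rectangle_integral !addrA (hor _ y1) (hor _ y2) (ver _ x1) (ver _ x2).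
ring.
Qed.

Lemma rectangle_integral_affine (k d : C) (a b x y w h : R) : 0 <= w -> 0 <= h ->
  rectangle_integral (fun s t => k + d * ((s - a) +i* (t - b))%C) x y w h = 0.
Proof.
move=> w0 h0; rewrite /rectangle_integral.
have row t : cintegral (fun s => k + d * ((s - a) +i* (t - b))%C) x (x + w) =
    cintegral (fun s => (k - d * (a +i* (b - t))%C) + d * s%:C%C) x (x + w).
  apply: eq_cintegral => s _; clear; case: d => d1 d2; case: k => k1 k2.
  by apply/eqP; rewrite eq_complex/=; apply/andP; split; apply/eqP; ring.
have col s : cintegral (fun t => k + d * ((s - a) +i* (t - b))%C) y (y + h) =
    cintegral (fun t => (k + d * ((s - a) +i* (- b))%C) + (d * 'i%C) * t%:C%C) y (y + h).
  apply: eq_cintegral => t _; clear; case: d => d1 d2; case: k => k1 k2.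
  by apply/eqP; rewrite eq_complex/=; apply/andP; split; apply/eqP; ring.
rewrite !row !col !cintegral_affine ?lerDl//; clear.
case: d => d1 d2; case: k => k1 k2.
by apply/eqP; rewrite eq_complex/=; apply/andP; split; apply/eqP; field.
Qed.

(** The bound is [2 * M] times the perimeter. The disjunctions ask for continuity only along the
    lines that carry the four sides, because in [goursat_local] nothing is known about [G] outside
    the closed rectangle. *)
Lemma rectangle_integral_le G x y w h (M : R) : 0 <= w -> 0 <= h ->
  (forall t, continuous_on (G ^~ t) x (x + w) \/ t != y /\ t != y + h) ->
  (forall s, continuous_on (G s) y (y + h) \/ s != x /\ s != x + w) ->
  (forall s t, x <= s <= x + w -> y <= t <= y + h -> nr (G s t) <= M) ->
  nr (rectangle_integral G x y w h) <= 4 * M * (w + h).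
Proof.
move=> w0 h0 cr cc GM.
have row t : t = y \/ t = y + h -> nr (cintegral (G ^~ t) x (x + w)) <= 2 * M * w.
  move=> ty; rewrite -[in leRHS](addKr x w) [- x + _]addrC.
  apply: nr_cintegral_le; rewrite ?lerDl//.
    by case: (cr t) => // -[/eqP ? /eqP ?]; case: ty.
  by move=> s sx; apply: GM => //; lra.
have col s : s = x \/ s = x + w -> nr (cintegral (G s) y (y + h)) <= 2 * M * h.
  move=> sx; rewrite -[in leRHS](addKr y h) [- y + _]addrC.
  apply: nr_cintegral_le; rewrite ?lerDl//.
    by case: (cc s) => // -[/eqP ? /eqP ?]; case: sx.
  by move=> t ty; apply: GM => //; lra.
have ni : nr ('i%C : C) = 1 by rewrite nr_def/= expr0n add0r expr1n sqrtr1.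
rewrite /rectangle_integral.
apply: (le_trans (nrB _ _)); rewrite nrM ni mul1r.
have h1 := nrB (cintegral (G^~ y) x (x + w) + 'i%C * cintegral (G (x + w)) y (y + h)) (cintegral (G^~ (y + h)) x (x + w)).
have h2 := nrD (cintegral (G^~ y) x (x + w)) ('i%C * cintegral (G (x + w)) y (y + h)).
rewrite nrM ni mul1r in h2.
have r1 := row y (or_introl erefl); have r2 := row (y + h) (or_intror erefl).
have c1 := col x (or_introl erefl); have c2 := col (x + w) (or_intror erefl).
rewrite (_ : 4 * M * _ = 2 * M * w + 2 * M * h + 2 * M * w + 2 * M * h); last ring.
rewrite lerD//; apply: (le_trans h1); rewrite lerD//; apply: (le_trans h2).
by rewrite lerD.
Qed.

(** Subtracting the affine part [A] of [G] at the point leaves the contour integral unchanged. The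
    remainder is at most [e * (w + h)] on a small rectangle, and the perimeter contributes a second
    factor [w + h]. *)
Lemma goursat_local G a b (e : R) : 0 < e -> cdiff_at G a b ->
  exists2 r, 0 < r & forall x y w h, 0 <= w -> 0 <= h -> w < r -> h < r ->
    x <= a <= x + w -> y <= b <= y + h ->
    (forall s t, x <= s <= x + w -> y <= t <= y + h -> cdiff_at G s t) ->
    nr (rectangle_integral G x y w h) <= e * (4 * (w + h) ^+ 2).
Proof.
move=> e0 [d dP]; have [r r0 rP] := dP _ e0.
exists r => // x y w h w0 h0 wr hr xa yb dG.
pose A s t := G a b + d * ((s - a) +i* (t - b))%C.
have cAr t : continuous_on (A ^~ t) x (x + w).
  apply: (@continuous_on_lip _ _ _ _ (nr d)) => s s'.
  rewrite /A opprD addrACA subrr add0r -mulrBr nrM ler_wpM2l ?nr_ge0//.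
  rewrite (le_trans (nr_le_ReIm _))//= subrr normr0 addr0.
  by rewrite opprB addrA subrK.
have cAc s : continuous_on (A s) y (y + h).
  apply: (@continuous_on_lip _ _ _ _ (nr d)) => t t'.
  rewrite /A opprD addrACA subrr add0r -mulrBr nrM ler_wpM2l ?nr_ge0//.
  rewrite (le_trans (nr_le_ReIm _))//= subrr normr0 add0r.
  by rewrite opprB addrA subrK.
have cGr t : y <= t <= y + h -> continuous_on (G ^~ t) x (x + w).
  by move=> yt; apply: cdiff_at_row => s xs; apply: dG.
have cGc s : x <= s <= x + w -> continuous_on (G s) y (y + h).
  by move=> xs; apply: cdiff_at_col => t yt; apply: dG.
have -> : rectangle_integral G x y w h = rectangle_integral (fun s t => G s t - A s t) x y w h.
  rewrite -[LHS]subr0 -(rectangle_integral_affine (G a b) d a b x y w0 h0) -/A.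
  rewrite /rectangle_integral.
  have y1 : y <= y <= y + h by lra.
  have y2 : y <= y + h <= y + h by lra.
  have x1 : x <= x <= x + w by lra.
  have x2 : x <= x + w <= x + w by lra.
  rewrite (cintegralB (cGr _ y1) (cAr _)) (cintegralB (cGr _ y2) (cAr _)).
  rewrite (cintegralB (cGc _ x1) (cAc _)) (cintegralB (cGc _ x2) (cAc _)).
  ring.
rewrite (_ : e * _ = 4 * (e * (w + h)) * (w + h)); last ring.
apply: rectangle_integral_le => //.
- move=> t; have [/cGr c|yt] := boolP (y <= t <= y + h).
    by left; apply: continuous_onB.
  by right; split; apply: contra yt => /eqP ->; lra.
- move=> s; have [/cGc c|xs] := boolP (x <= s <= x + w).
    by left; apply: continuous_onB.
  by right; split; apply: contra xs => /eqP ->; lra.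
- move=> s t xs yt; have sa : `|s - a| <= w by rewrite ler_norml; lra.
  have tb : `|t - b| <= h by rewrite ler_norml; lra.
  have := rP (s - a) (t - b) (le_lt_trans sa wr) (le_lt_trans tb hr).
  rewrite (_ : a + (s - a) = s); last by ring.
  rewrite (_ : b + (t - b) = t); last by ring.
  rewrite /A opprD addrA => H; apply: (le_trans H).
  by rewrite ler_pM2l// lerD.
Qed.

(** The bound proved for scale [t] is proportional to [t ^+ 2], so the bounds of the four quarters
    add up exactly to that of the whole. Bisection thus reduces it to small rectangles, where it is
    [goursat_local]. *)
Lemma goursat G x0 y0 w h : 0 <= w -> 0 <= h ->
  (forall x y, x0 <= x <= x0 + w -> y0 <= y <= y0 + h -> cdiff_at G x y) ->
  rectangle_integral G x0 y0 w h = 0.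
Proof.
move=> w0 h0 dG; apply/eqP; rewrite -nr_eq0 -[_ == _]orFb.
rewrite eq_le nr_ge0 andbT; apply/ler_addgt0Pr => e e0; rewrite add0r.
have wh : 0 < 4 * (w + h) ^+ 2 + 1 by rewrite ltr_wpDl// mulr_ge0// sqr_ge0.
(* The summand 1 in the denominator covers the degenerate case [w = h = 0]. *)
pose e' := e / (4 * (w + h) ^+ 2 + 1).
have e'0 : 0 < e' by rewrite divr_gt0.
suff H : nr (rectangle_integral G x0 y0 (w * 1) (h * 1)) <= e' * (4 * (w + h) ^+ 2) * 1 ^+ 2.
  rewrite !mulr1 in H; apply: (le_trans H); rewrite expr1n mulr1 /e' mulrAC ler_pdivrMr//.
  by rewrite ler_pM2l// lerDl.
apply: (@bisection_square R (fun x y t =>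
  nr (rectangle_integral G x y (w * t) (h * t)) <= e' * (4 * (w + h) ^+ 2) * t ^+ 2) x0 y0 w h) => //.
- move=> x y t t0 [x1 x2 y1 y2] p1 p2 p3 p4.
  have t2 : 0 <= t / 2 by lra.
  have wt : 0 <= w * (t / 2) by rewrite mulr_ge0.
  have ht : 0 <= h * (t / 2) by rewrite mulr_ge0.
  have -> : w * t = w * (t / 2) + w * (t / 2) by field.
  have -> : h * t = h * (t / 2) + h * (t / 2) by field.
  have wt2 : w * t = w * (t / 2) + w * (t / 2) by field.
  have ht2 : h * t = h * (t / 2) + h * (t / 2) by field.
  rewrite rectangle_integral_split//; last first.
    by move=> a b xa yb; apply: dG; lra.
  rewrite [leRHS](_ : _ = e' * (4 * (w + h) ^+ 2) * (t / 2) ^+ 2 + e' * (4 * (w + h) ^+ 2) * (t / 2) ^+ 2 + e' * (4 * (w + h) ^+ 2) * (t / 2) ^+ 2 + e' * (4 * (w + h) ^+ 2) * (t / 2) ^+ 2); last by field.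
  do 3 (apply: le_trans (nrD _ _) _; apply: lerD => //).
- move=> a b xa yb; have [r r0 rP] := goursat_local e'0 (dG _ _ xa yb).
  have wh1 : 0 < w + h + 1 by lra.
  exists (r / (w + h + 1)); first by rewrite divr_gt0.
  move=> x y t /andP[t0]; rewrite ltr_pdivlMr// => tr [x1 x2 y1 y2] xat ybt.
  have wt : 0 <= w * t by rewrite mulr_ge0// ltW.
  have ht : 0 <= h * t by rewrite mulr_ge0// ltW.
  rewrite [leRHS](_ : _ = e' * (4 * (w * t + h * t) ^+ 2)); last by ring.
  apply: rP => //; try lra.
  by move=> s u xs yu; apply: dG; lra.
Qed.

End Goursat.

(** * Means of curves in convex sets, and the exponential *)

Section CircleAverages.
Variable R : realType.
Local Notation C := R[i].

Definition convexr n (E : set 'rV[C]_n) := forall x y (t : R), 0 <= t <= 1 ->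
  E x -> E y -> E ((1 - t)%:C%C *: x + t%:C%C *: y).

Lemma cintegral_convex n (g : R -> 'rV[C]_n) (E : set 'rV[C]_n) (a b : R) :
  a <= b -> convexr E -> (forall x, a <= x <= b -> E (g x)) ->
  continuous_on g a b -> forall e, 0 < e -> exists2 c, E c &
    forall j, nr (cintegral (fun x => g x 0 j) a b - (b - a)%:C%C * c 0 j) <= e * (b - a).
Proof.
move=> ab cE gE cg e e0.
have cgj j x z : a <= x -> z <= b -> continuous_on (fun x => g x 0 j) x z.
  move=> ax zb y xyz e' e'0.
  have [d d0 dP] := cg y ltac:(lra) _ e'0; exists d => // y' /dP.
  apply: le_lt_trans; rewrite [leLHS](_ : _ = nr ((g y' - g y) 0 j)) ?nr_entry//.
  by rewrite !mxE.
apply: (@bisection R (fun a b => exists2 c, E c &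
    forall j, nr (cintegral (fun x => g x 0 j) a b - (b - a)%:C%C * c 0 j) <= e * (b - a))) => //.
- move=> x z ax xz zb [c Ec cP] [c' Ec' c'P].
  exists ((1 - 2^-1)%:C%C *: c + (2^-1)%:C%C *: c') => [|j].
    by apply: cE => //; lra.
  have xm : x <= (x + z) / 2 by lra.
  have mz : (x + z) / 2 <= z by lra.
  rewrite (cintegral_cat xm mz (cgj _ _ _ ax zb)) !mxE.
  have := lerD (cP j) (c'P j); rewrite -mulrDr [in leRHS](_ : (x + z) / 2 - x + (z - (x + z) / 2) = z - x); last by field.
  apply: le_trans; apply: le_trans (nrD _ _); rewrite le_eqVlt; apply/orP; left; apply/eqP.
  congr nr; rewrite (_ : 1 - 2^-1 = 2^-1 :> R); last by field.
  have -> : (x + z) / 2 - x = (z - x) * 2^-1 by field.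
  have -> : z - (x + z) / 2 = (z - x) * 2^-1 by field.
  by rewrite [in RHS]rmorphM/=; ring.
- move=> c cab; have [d d0 dP] := cg c cab (e / 2) ltac:(by rewrite divr_gt0).
  exists d => // x z xc cz zx; exists (g c) => [|j]; first exact: gE.
  have xz : x <= z by lra.
  have -> : (z - x)%:C%C * g c 0 j = cintegral (fun=> g c 0 j) x z.
    have := cintegral_affine (g c 0 j) 0 xz; rewrite mul0r addr0 mulrC => <-.
    by apply: eq_cintegral => y _; rewrite mul0r addr0.
  rewrite -cintegralB; [|by apply: cgj; lra|exact: continuous_on_cst].
  rewrite (_ : e * (z - x) = 2 * (e / 2) * (z - x)); last by field.
  apply: nr_cintegral_le => //.
    by apply: continuous_onB; [apply: cgj; lra|exact: continuous_on_cst].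
  move=> y xyz; apply/ltW; apply: le_lt_trans (dP y _).
    by rewrite [leLHS](_ : _ = nr ((g y - g c) 0 j)) ?nr_entry// !mxE.
  by rewrite ltr_norml; lra.
Qed.

(** The exponential of s + i t. It turns rectangles into annuli, so that Goursat's theorem for
    rectangles speaks of circles around 0. *)
Definition polar (s t : R) : C := (expR s * cos t +i* (expR s * sin t))%C.

Lemma polarD s t a b : polar (s + a) (t + b) = polar s t * polar a b.
Proof.
rewrite /polar expRD cosD sinD; apply/eqP; rewrite eq_complex/=.
by apply/andP; split; apply/eqP; ring.
Qed.

Lemma nr_polar s t : nr (polar s t) = expR s.
Proof.
rewrite nr_def/= !exprMn -mulrDr cos2Dsin2 mulr1 sqrtr_sqr ger0_norm//.
Qed.

Lemma polar_neq0 s t : polar s t != 0.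
Proof. by rewrite -nr_eq0 nr_polar gt_eqF ?expR_gt0. Qed.

Lemma is_derive_small (f : R -> R) (l : R) : is_derive (0 : R) 1 f l ->
  forall e : R, 0 < e -> exists2 r, 0 < r & forall h, `|h| < r ->
    `|f h - f 0 - l * h| <= e * `|h|.
Proof.
move=> df e e0; have fl : (fun h => h^-1 *: (f (h *: 1 + 0) - f 0)) @ (0 : R)^' --> l.
  by have := @ex_derive _ _ _ _ _ _ _ df; rewrite /derivable -(@derive_val _ _ _ _ _ _ _ df).
move/cvgrPdist_lt : fl => /(_ _ e0) [r /= r0 rP]; exists r => // h hr.
have [->|h0] := eqVneq h 0; first by rewrite subrr mulr0 subrr !normr0 mulr0.
have := rP h; rewrite /= sub0r normrN => /(_ hr h0)/ltW.
rewrite addr0 /GRing.scale/= mulr1 => H.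
have -> : f h - f 0 - l * h = - ((l - h^-1 * (f h - f 0)) * h) by field.
by rewrite normrN normrM ler_wpM2r.
Qed.

(** The exponential has derivative 1 at 0; through [polarD] this gives its derivative everywhere. *)
Lemma polar_diff0 (e : R) : 0 < e -> exists2 r, 0 < r & forall a b : R, `|a| < r -> `|b| < r ->
  nr (polar a b - 1 - (a +i* b)%C) <= e * (`|a| + `|b|).
Proof.
(* With relative error [e'] in exp, cos and sin, the errors of the real and imaginary parts add up
   to at most 5 [e'] times [|a| + |b|]; [e' <= 1] serves to bound the mixed terms. *)
move=> e0; have [e' [e'0 e1 e5]] : exists e', [/\ 0 < e', e' <= 1 & e' <= e / 5].
  exists (Num.min 1 (e / 5)); split; last by rewrite ge_min lexx orbT.
    by rewrite lt_min ltr01 divr_gt0.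
  by rewrite ge_min lexx.
have [r1 r10 P1] := is_derive_small (is_derive_expR (0 : R)) e'0.
have [r2 r20 P2] := is_derive_small (is_derive_cos (0 : R)) e'0.
have [r3 r30 P3] := is_derive_small (is_derive_sin (0 : R)) e'0.
rewrite expR0 in P1; rewrite cos0 sin0 in P2; rewrite cos0 sin0 in P3.
exists (Num.min (Num.min r1 r2) (Num.min r3 e')) => [|a b]; first by rewrite !lt_min r10 r20 r30.
rewrite !lt_min => /andP[/andP[a1 a2] /andP[a3 a4]] /andP[/andP[b1 b2] /andP[b3 b4]].
apply: le_trans (nr_le_ReIm _) _ => /=.
have A := P1 _ a1; have B := P2 _ b2; have D := P3 _ b3.
set al := expR a - 1 - 1 * a in A.
set be := cos b - 1 - -0 * b in B.
set ga := sin b - 0 - 1 * b in D.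
have -> : expR a = 1 + a + al by rewrite /al; ring.
have -> : cos b = 1 + be by rewrite /be; ring.
have -> : sin b = b + ga by rewrite /ga; ring.
have aa : `|a + al| <= 2 * `|a|.
  have := ler_normD a al; have : e' * `|a| <= `|a| by rewrite ler_piMl.
  by move: A; clear; lra.
have bb : `|b + ga| <= 2 * `|b|.
  have := ler_normD b ga; have : e' * `|b| <= `|b| by rewrite ler_piMl.
  by move: D; clear; lra.
have t1 : `|(1 + a + al) * (1 + be) - 1 - a| <= e' * `|a| + 3 * (e' * `|b|).
  have -> : (1 + a + al) * (1 + be) - 1 - a = al + be * (1 + (a + al)) by ring.
  apply: le_trans (ler_normD _ _) _; rewrite lerD// normrM mulrC.
  apply: ler_pM => //; apply: le_trans (ler_normD _ _) _; rewrite normr1.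
  by move: aa a4 e1; clear; lra.
have t2 : `|(1 + a + al) * (b + ga) - 0 - b| <= e' * `|b| + 4 * (e' * `|a|).
  have -> : (1 + a + al) * (b + ga) - 0 - b = ga + (a + al) * (b + ga) by ring.
  apply: le_trans (ler_normD _ _) _; rewrite lerD// normrM.
  apply: le_trans (ler_pM _ _ aa bb) _ => //.
  have -> : 2 * `|a| * (2 * `|b|) = 4 * (`|b| * `|a|) by ring.
  by rewrite ler_pM2l// ler_wpM2r// ltW.
rewrite subr0 in t2 *.
have h1 : e' * `|a| <= e / 5 * `|a| by rewrite ler_wpM2r.
have h2 : e' * `|b| <= e / 5 * `|b| by rewrite ler_wpM2r.
have p1 : 0 <= e / 5 * `|a| by rewrite mulr_ge0// divr_ge0// ltW.
have p2 : 0 <= e / 5 * `|b| by rewrite mulr_ge0// divr_ge0// ltW.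
rewrite (_ : e * (`|a| + `|b|) = 5 * (e / 5 * `|a|) + 5 * (e / 5 * `|b|)); last by field.
by move: t1 t2 h1 h2 p1 p2; clear; lra.
Qed.

End CircleAverages.

(** * The mean value property and the Schwarz lemma *)

Section Schwarz.
Variable R : realType.
Local Notation C := R[i].

Lemma diff_nr (V W : normedModType C) (f : V -> W) x : differentiable f x ->
  forall e : R, 0 < e -> exists2 r, 0 < r & forall h, nr h < r ->
   nr (f (x + h) - f x - 'd f x h) <= e * nr h.
Proof.
move=> df e e0; have := diff_locally df => /eqaddoP /(_ e%:C%C).
rewrite ltcR => /(_ e0)/near_nr[r r0 rP]; exists r => // h hr.
have := rP h; rewrite subr0 => /(_ hr); rewrite /= !nrE -rmorphM lecR/=.
by rewrite !fctE/= [h + x]addrC opprD addrA.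
Qed.

Lemma differentiable_compN (V : normedModType C) (f : C -> V) (z : C) :
  differentiable f (- z) -> differentiable (fun z : C => f (- z)) z.
Proof.
have dN : differentiable (fun z : C => - z) z by exact: differentiableN.
exact: (@differentiable_comp _ (C : normedModType C) _ _ _ _ _ dN).
Qed.

Lemma differentiable_entry n (V : normedModType C) (f : V -> 'rV[C]_n) z j :
  differentiable f z -> differentiable (fun z => f z 0 j : C) z.
Proof.
move=> fz.
exact: (@differentiable_comp _ _ _ _ f (fun x : 'rV[C]_n => x 0 j : C) z fz
  (differentiable_coord _ _ _)).
Qed.

Lemma differentiable_mul (V : normedModType C) (f g : V -> C) z :
  differentiable f z -> differentiable g z -> differentiable (fun z => f z * g z) z.
Proof. exact: differentiableM. Qed.

Lemma differentiable_inv (V : normedModType C) (f : V -> C) z :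
  differentiable f z -> f z != 0 -> differentiable (fun z => (f z)^-1) z.
Proof. exact: differentiableV. Qed.

Lemma differentiable_nr (V W : normedModType C) (f : V -> W) x : differentiable f x ->
  forall e : R, 0 < e -> exists2 r, 0 < r & forall y, nr (y - x) < r -> nr (f y - f x) < e.
Proof.
move=> /differentiable_continuous fx e e0.
apply/near_nr; have [_ /cvgrPdist_lt /(_ e%:C%C)] := (fx, fx).
rewrite ltcR => /(_ e0); apply: filterS => y.
by rewrite nrE ltcR nrBC.
Qed.

Lemma differentiable_nr_scale (V W : normedModType C) (k : V -> C) (f : V -> W) x :
  differentiable k x -> differentiable f x ->
  forall e : R, 0 < e -> exists2 r, 0 < r & forall y, nr (y - x) < r ->
    nr (k y *: f y - k x *: f x) < e.
Proof.
move=> dk df e e0; have f1 : 0 < nr (f x) + 1 by rewrite ltr_wpDl ?nr_ge0.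
have k1 : 0 < nr (k x) + 1 by rewrite ltr_wpDl ?nr_ge0.
have e2 : 0 < e / 2 by rewrite divr_gt0.
have [r1 r10 P1] := differentiable_nr dk ltr01.
have [r2 r20 P2] := differentiable_nr dk (divr_gt0 e2 f1).
have [r3 r30 P3] := differentiable_nr df (divr_gt0 e2 k1).
exists (Num.min r1 (Num.min r2 r3)) => [|y]; first by rewrite !lt_min r10 r20.
rewrite !lt_min => /and3P[/P1 y1 /P2 y2 /P3 y3].
have -> : k y *: f y - k x *: f x = k y *: (f y - f x) + (k y - k x) *: f x.
  by rewrite scalerBr scalerBl subrKA.
apply: le_lt_trans (nrD _ _) _; rewrite !nrZ [e]splitr.
have ky : nr (k y) <= nr (k x) + 1.
  rewrite -[k y](subrK (k x)) addrC; apply: le_trans (nrD _ _) _.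
  by rewrite lerD2l ltW.
rewrite ltr_pdivlMr// in y2; rewrite ltr_pdivlMr// in y3.
apply: ler_ltD; [apply: le_trans (ltW y3); rewrite mulrC|apply: le_lt_trans y2].
  by rewrite ler_wpM2l ?nr_ge0.
by rewrite ler_wpM2l ?nr_ge0// lerDl.
Qed.

Lemma diff1Z (V : normedModType C) (f : C -> V) z (h : C) :
  differentiable f z -> 'd f z h = h *: 'd f z 1.
Proof. by move=> df; rewrite -linearZ/= [h *: 1]mulr1. Qed.

(** The chain rule for g after the exponential: the derivative is [D * z]. The error is split
    between the remainder of [g] at [z] and that of the exponential. *)
Lemma cdiff_at_polar (g : C -> C) s t :
  differentiable g (polar s t) -> cdiff_at (fun s t => g (polar s t)) s t.
Proof.
move=> dg; set z := polar s t; set D := 'd g z 1.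
exists (D * z) => e e0.
have z0 : 0 < nr z by rewrite nr_polar expR_gt0.
have D1 : 0 < nr D + 1 by rewrite ltr_wpDl ?nr_ge0.
have [r r0 rP] := diff_nr dg (e := e / 4 / nr z) ltac:(by rewrite !divr_gt0).
have [r1 r10 P1] := polar_diff0 (@ltr01 R).
have [r2 r20 P2] := @polar_diff0 R (e / 2 / ((nr D + 1) * nr z)) ltac:(by rewrite !divr_gt0 ?mulr_gt0).
exists (Num.min (Num.min r1 r2) (r / (4 * nr z))).
  by rewrite !lt_min r10 r20 divr_gt0 ?mulr_gt0.
move=> a b; rewrite !lt_min => /andP[/andP[a1 a2] a3] /andP[/andP[b1 b2] b3].
have H1 := P1 _ _ a1 b1; have H2 := P2 _ _ a2 b2; rewrite mul1r in H1.
rewrite polarD -/z; set k := z * (polar a b - 1).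
have nab : nr (a +i* b)%C <= `|a| + `|b| by exact: nr_le_ReIm.
have nk : nr k <= 2 * nr z * (`|a| + `|b|).
  rewrite nrM [2 * _]mulrC -mulrA ler_pM2l//.
  rewrite -[polar a b - 1](subrK (a +i* b)%C); apply: le_trans (nrD _ _) _.
  by move: H1 nab; clear; lra.
have kr : nr k < r.
  apply: le_lt_trans nk _; rewrite ltr_pdivlMr ?mulr_gt0// in a3.
  rewrite ltr_pdivlMr ?mulr_gt0// in b3.
  rewrite (_ : 2 * nr z * _ = (`|a| * (4 * nr z) + `|b| * (4 * nr z)) / 2); last by field.
  by move: a3 b3; clear; lra.
have := rP _ kr; rewrite -/z (_ : z + k = z * polar a b); last by rewrite /k; ring.
rewrite (diff1Z _ dg) -/z -/D [k *: D]mulrC => H3.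
have -> : g (z * polar a b) - g z - D * z * (a +i* b)%C =
    (g (z * polar a b) - g z - D * k) + D * z * (polar a b - 1 - (a +i* b)%C).
  by rewrite /k; ring.
apply: le_trans (nrD _ _) _; rewrite 2!nrM.
have H4 : nr (g (z * polar a b) - g z - D * k) <= e / 2 * (`|a| + `|b|).
  apply: le_trans H3 _; apply: le_trans (_ : e / 4 / nr z * (2 * nr z * (`|a| + `|b|)) <= _).
    by rewrite ler_pM2l// !divr_gt0.
  by rewrite le_eqVlt; apply/orP; left; apply/eqP; field; rewrite gt_eqF.
have H5 : nr D * nr z * nr (polar a b - 1 - (a +i* b)%C) <= e / 2 * (`|a| + `|b|).
  apply: le_trans (_ : (nr D + 1) * nr z * (e / 2 / ((nr D + 1) * nr z) * (`|a| + `|b|)) <= _).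
    apply: ler_pM => //; rewrite ?mulr_ge0 ?nr_ge0//.
    by rewrite ler_pM2r// lerDl.
  by rewrite le_eqVlt; apply/orP; left; apply/eqP; field; rewrite !gt_eqF.
by move: H4 H5; clear; lra.
Qed.

(** On the rectangle from [s'] to [s] and from 0 to 2 pi the two horizontal sides cancel, so the
    mean over a circle does not depend on its radius; for small circles it is close to [d]. Nothing
    is asked of [g] at 0 itself, because the lemma is applied to a quotient by [z]. *)
Lemma mean_value (g : C -> C) (d : C) (rho s : R) :
  (forall e : R, 0 < e -> exists2 r, 0 < r & forall z, z != 0 -> nr z < r -> nr (g z - d) < e) ->
  (forall z, z != 0 -> nr z < rho -> differentiable g z) ->
  expR s < rho ->
  cintegral (fun t => g (polar s t)) 0 (pi *+ 2) = (pi *+ 2)%:C%C * d.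
Proof.
move=> g0 dg srho; set M := fun s => cintegral (fun t => g (polar s t)) 0 (pi *+ 2).
rewrite -/(M s).
have pi2 : 0 <= pi *+ 2 :> R by rewrite mulrn_wge0// pi_ge0.
have dG s' t : s' <= s -> cdiff_at (fun s t => g (polar s t)) s' t.
  move=> s's; apply: cdiff_at_polar; apply: dg; first exact: polar_neq0.
  by rewrite nr_polar (le_lt_trans _ srho)// ler_expR.
have MM s' : s' <= s -> M s' = M s.
  move=> s's; have w0 : 0 <= s - s' by lra.
  have := @goursat R (fun s t => g (polar s t)) s' 0 (s - s') (pi *+ 2) w0 pi2.
  rewrite /rectangle_integral add0r (addrC s') subrK.
  (* The exponential has period 2 pi i. *)
  have -> : cintegral (fun x => g (polar x (pi *+ 2))) s' s = cintegral (fun x => g (polar x 0)) s' s.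
    by apply: eq_cintegral => x _; rewrite /polar cos2pi sin2pi cos0 sin0.
  rewrite -/(M s) -/(M s') => H; apply/eqP; rewrite -subr_eq0; apply/eqP.
  have i0 : 'i%C != 0 :> C by rewrite eq_complex/= oner_eq0 andbF.
  apply: (mulfI i0); rewrite mulr0 -[RHS]oppr0 -H; first by ring.
  by move=> x y /andP[_ xs] _; exact: dG.
apply/eqP; rewrite -subr_eq0 -nr_eq0 eq_le nr_ge0 andbT.
apply/ler_addgt0Pr => e e0; rewrite add0r.
have p1 : 0 < 2 * (pi *+ 2) + 1 :> R by lra.
have [r r0 rP] := g0 (e / (2 * (pi *+ 2) + 1)) ltac:(by rewrite divr_gt0).
pose s1 := Num.min s (ln (r / 2)).
have s1s : s1 <= s by rewrite ge_min lexx.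
have s1r : expR s1 < r.
  apply: le_lt_trans (_ : r / 2 < r); last by lra.
  by rewrite -[leRHS]lnK ?ler_expR ?posrE ?divr_gt0// ge_min lexx orbT.
rewrite -(MM _ s1s).
have cM : continuous_on (fun t => g (polar s1 t)) 0 (pi *+ 2).
  by apply: (@cdiff_at_col _ (fun s t => g (polar s t))) => y _; exact: dG.
have -> : (pi *+ 2)%:C%C * d = cintegral (fun=> d) 0 (pi *+ 2) :> C.
  have := cintegral_affine d 0 pi2; rewrite mul0r addr0 mulrC subr0 => <-.
  by apply: eq_cintegral => y _; rewrite mul0r addr0.
rewrite -cintegralB//; last exact: continuous_on_cst.
apply: le_trans (nr_cintegral_le (M := e / (2 * (pi *+ 2) + 1)) pi2 _ _) _.
- by apply: continuous_onB => //; exact: continuous_on_cst.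
- by move=> t _; apply/ltW/rP; rewrite ?polar_neq0// nr_polar.
- rewrite subr0 [2 * _]mulrC -mulrA mulrAC ler_pdivrMr//.
  by rewrite ler_pM2l// lerDl.
Qed.

(* The odd part F of f has the derivative of f at 0 and values in E; the mean
   over |z| = r of (r / z) F z, which takes values in E, is r f'(0). *)
Lemma schwarz_convex n (E : set 'rV[C]_n) (f : C -> 'rV[C]_n) (rho r : R) :
  convexr E -> balanced E ->
  (forall z, nr z < rho -> E (f z) /\ differentiable f z) -> 0 < r < rho ->
  closure E (r%:C%C *: 'd f 0 1).
Proof.
move=> cE bE fE /andP[r0 rrho]; have rho0 : 0 < rho by lra.
(* Subtracting [f 0] would lead out of [E]; the odd part also vanishes at 0, and it is the midpoint
   of [f z] and [- f (- z)], both in [E]. *)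
pose F z := 2^-1 *: (f z - f (- z)).
have EF z : nr z < rho -> E (F z).
  move=> zr; have [Ez _] := fE _ zr; have [] := fE (- z); first by rewrite nrN.
  move=> /bE /(_ (-1)); rewrite normrN normr1 lexx scaleN1r => /(_ erefl) E1 _.
  have := cE _ _ 2^-1 _ Ez E1; rewrite (_ : 1 - 2^-1 = 2^-1 :> R); last by field.
  rewrite -scalerDr -/(F z) fmorphV/= rmorph_nat; apply; lra.
have dF z : nr z < rho -> differentiable F z.
  move=> zr; apply: differentiableZ; apply: differentiableB; first by have [] := fE z zr.
  have [_ dz] := fE (- z) ltac:(by rewrite nrN).
  exact: differentiable_compN.
set d := 'd f 0 1.
have F0 : forall e : R, 0 < e -> exists2 r, 0 < r & forall z, nr z < r ->
    nr (F z - z *: d) <= e * nr z.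
  move=> e e0; have df0 : differentiable f 0 by have [] := fE 0 ltac:(by rewrite nr0).
  have [q q0 qP] := diff_nr df0 e0; exists q => // z zq.
  have := qP z zq; have := qP (- z) ltac:(by rewrite nrN).
  rewrite !add0r (diff1Z z)// (diff1Z (- z))// nrN -/d => H1 H2.
  have -> : F z - z *: d = 2^-1 *: ((f z - f 0 - z *: d) - (f (- z) - f 0 - (- z) *: d)).
    apply/rowP => j; rewrite !mxE; field.
    by [].
  rewrite nrZ nrV nr_nat.
  move: (nrB (f z - f 0 - z *: d) (f (- z) - f 0 - (- z) *: d)) H1 H2.
  by move: (nr _) (nr _) (nr _) (nr z) => a1 a2 a3 a4; clear; lra.
pose s := ln r; have sr : expR s = r by rewrite lnK.
pose g (z : C) := (r%:C%C * z^-1) *: F z.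
have gE z j : g z 0 j = r%:C%C * z^-1 * F z 0 j by rewrite mxE.
have dg (z : C) : z != 0 -> differentiable (fun z : C => r%:C%C * z^-1) z.
  move=> z0; apply: differentiable_mul; first exact: differentiable_cst.
  exact: (@differentiable_inv _ id).
have igE j : cintegral (fun t => g (polar s t) 0 j) 0 (pi *+ 2) =
    (pi *+ 2)%:C%C * (r%:C%C * d 0 j).
  apply: (@mean_value (fun z => g z 0 j) (r%:C%C * d 0 j) rho s); last by rewrite sr.
    move=> e e0; have [q q0 qP] := F0 (e / (2 * r)) ltac:(by rewrite divr_gt0 ?mulr_gt0).
    exists q => // z z0 /qP H; have nz : 0 < nr z by rewrite lt_neqAle eq_sym nr_eq0 z0 nr_ge0.
    have -> : g z 0 j - r%:C%C * d 0 j = r%:C%C * z^-1 * (F z - z *: d) 0 j.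
      by rewrite gE !mxE; field.
    rewrite 2!nrM nrV nr_real ger0_norm ?ltW// mulrAC ltr_pdivrMr//.
    apply: le_lt_trans (_ : r * (e / (2 * r) * nr z) < _).
      by rewrite ler_pM2l//; apply: le_trans H; exact: nr_entry.
    rewrite mulrA ltr_pM2r// (_ : r * _ = e / 2); last by field; rewrite gt_eqF.
    by move: e0; clear; lra.
  move=> z z0 zr; under eq_fun do rewrite gE.
  by apply: differentiable_mul; [exact: dg|apply: differentiable_entry; exact: dF].
apply/closure_nr => e e0.
have pi2 : 0 < pi *+ 2 :> R by rewrite mulrn_wgt0// pi_gt0.
have e20 : 0 < e / 2 by rewrite divr_gt0.
have [||c Ec cP] := @cintegral_convex R n (fun t => g (polar s t)) E 0 (pi *+ 2) (ltW pi2) cE _ _ (e / 2) e20.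
(* On the circle of radius [r] the factor r / z has modulus 1, so [E], being balanced, contains the
   values of [g] there. *)
- move=> t _; apply: bE; first by apply: EF; rewrite nr_polar sr.
  by rewrite nrE lecR nrM nrV nr_polar sr nr_real ger0_norm ?mulfV ?gt_eqF// ltW.
- move=> t _ e' e'0; set z := polar s t; have z0 : z != 0 by exact: polar_neq0.
  have [q q0 qP] : exists2 q, 0 < q & forall y, nr (y - z) < q -> nr (g y - g z) < e'.
    have Fz : differentiable F z by apply: dF; rewrite nr_polar sr.
    exact: differentiable_nr_scale (dg z z0) Fz _ e'0.
  have pt : cdiff_at (fun s t => polar s t) s t by apply: (@cdiff_at_polar id).
  have [u u0 uP] := cdiff_at_continuous pt q0.
  exists u => // y ty; apply: qP; have := uP 0 (y - t).
  by rewrite normr0 addr0 (addrC t) subrK; apply.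
exists c => //; apply: le_lt_trans (_ : e / 2 < e); last by move: e0; clear; lra.
apply: nr_matrix_le; first exact: ltW.
move=> i j; rewrite !ord1; have := cP j; rewrite subr0 igE.
have -> : (pi *+ 2)%:C%C * (r%:C%C * d 0 j) - (pi *+ 2)%:C%C * c 0 j =
   - ((pi *+ 2)%:C%C * (c - r%:C%C *: d) 0 j) by rewrite !mxE; ring.
by rewrite nrN nrM nr_real (ger0_norm (ltW pi2)) [X in X <= _ -> _]mulrC ler_pM2r.
Qed.

End Schwarz.

(** * Cauchy, Lipschitz, Taylor and Harnack estimates *)

Section Estimates.
Variable R : realType.
Local Notation C := R[i].

Lemma slice_diff (V W : normedModType C) (f : V -> W) z v (t : C) :
  differentiable f (z + t *: v) ->
  differentiable (fun t : C => f (z + t *: v)) t /\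
  'd (fun t : C => f (z + t *: v)) t 1 = 'd f (z + t *: v) v.
Proof.
move=> df.
have i0 : is_diff (t : C) (cst z + ( *:%R^~ v)) (0 + ( *:%R^~ v)).
  exact: (is_diffD (is_diff_cst z t) (is_diff_scalel t v)).
have i1 : is_diff ((cst z + ( *:%R^~ v)) t) f ('d f (z + t *: v)).
  by apply: DiffDef.
have [d1 d2] := is_diff_comp i0 i1.
split; first exact: d1.
transitivity ('d (f \o (cst z + ( *:%R^~ v))) t (1 : C)); first by [].
by rewrite d2 /= !fctE/= add0r scale1r.
Qed.

Lemma shift_diff (V W : normedModType C) (f : V -> W) y w :
  differentiable f (y + w) ->
  differentiable (fun y => f (y + w)) y /\
  forall v, 'd (fun y => f (y + w)) y v = 'd f (y + w) v.
Proof.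
move=> df.
have j0 : is_diff y (id + cst w) (id + 0).
  exact: (is_diffD (is_diff_id y) (is_diff_cst w y)).
have j1 : is_diff ((id + cst w) y) f ('d f (y + w)) by apply: DiffDef.
have [k1 k2] := is_diff_comp j0 j1.
split=> [|v]; first exact: k1.
have := congr1 (fun h : V -> W => h v) k2.
by rewrite /= !fctE /= addr0.
Qed.

Lemma sub_diff (V W : normedModType C) (f g : V -> W) x :
  differentiable f x -> differentiable g x ->
  differentiable (fun x => f x - g x) x /\
  forall v, 'd (fun x => f x - g x) x v = 'd f x v - 'd g x v.
Proof.
move=> df dg.
have j0 : is_diff x f ('d f x) by apply: DiffDef.
have j1 : is_diff x g ('d g x) by apply: DiffDef.
have [k1 k2] := is_diffB j0 j1.
split=> [|v]; first exact: k1.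
exact: (congr1 (fun h : V -> W => h v) k2).
Qed.

Lemma scalel_diff (V : normedModType C) (w : V) (t : C) :
  differentiable (fun t : C => t *: w) t /\ 'd (fun t : C => t *: w) t 1 = w.
Proof.
have [k1 k2] := is_diff_scalel t w.
split; first exact: k1.
by have := congr1 (fun h : C -> V => h 1) k2; rewrite /= scale1r.
Qed.

(** On a short interval around a point the slope is at most [K + e], and such bounds add up under
    bisection. *)
Lemma mean_value_ineq (V : normedModType C) (f : C -> V) (K : R) :
  (forall t : R, 0 <= t <= 1 ->
     differentiable f (t%:C%C : C) /\ nr ('d f (t%:C%C : C) (1 : C)) <= K) ->
  nr (f 1 - f 0) <= K.
Proof.
move=> df; apply/ler_addgt0Pr => e e0.
suff : nr (f (1%:C)%C - f (0%:C)%C) <= (K + e) * (1 - 0) by rewrite subr0 mulr1.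
apply: (@bisection R (fun a b => nr (f b%:C%C - f a%:C%C) <= (K + e) * (b - a)) 0 1) => //.
  move=> x z _ _ _ h1 h2; apply: le_trans (nr_tri _ (f ((x + z) / 2)%:C%C) _) _.
  apply: le_trans (lerD h2 h1) _.
  by rewrite -mulrDr le_eqVlt; apply/orP; left; apply/eqP; congr (_ * _); field.
move=> c c01; have [dfc Kc] := df c c01.
have [r r0 rP] := diff_nr dfc e0.
have key h : `|h| < r -> nr (f (c + h)%:C%C - f c%:C%C) <= (K + e) * `|h|.
  move=> hr; have := rP h%:C%C; rewrite nr_real => /(_ hr).
  rewrite diff1Z// -rmorphD => H.
  rewrite -[X in nr X](subrK (h%:C%C *: 'd f (c%:C%C : C) (1 : C))).
  apply: le_trans (nrD _ _) _; rewrite nrZ nr_real mulrDl addrC lerD//.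
  by rewrite mulrC ler_wpM2r.
exists r => // x z /andP[x0 xc] /andP[cz z1] zx.
have h1 := key (z - c) ltac:(rewrite ger0_norm; move: xc cz zx; clear; lra).
have h2 := key (x - c) ltac:(rewrite ler0_norm; move: xc cz zx; clear; lra).
rewrite (addrC c) subrK ger0_norm ?subr_ge0// in h1.
rewrite (addrC c) subrK ler0_norm ?subr_le0// nrBC in h2.
apply: le_trans (nr_tri _ (f c%:C%C) _) _; apply: le_trans (lerD h1 h2) _.
by rewrite -mulrDr le_eqVlt; apply/orP; left; apply/eqP; congr (_ * _); ring.
Qed.

Lemma ball_convexr n (M : R) : convexr [set x : 'rV[C]_n | nr x <= M].
Proof.
move=> x y t /andP[t0 t1] /= xM yM; apply: le_trans (nrD _ _) _.
rewrite !nrZ !nr_real !ger0_norm ?subr_ge0//.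
have -> : M = (1 - t) * M + t * M by ring.
by rewrite lerD// ler_wpM2l ?subr_ge0.
Qed.

Lemma ball_balanced n (M : R) : balanced [set x : 'rV[C]_n | nr x <= M].
Proof.
move=> x /= xM z; rewrite nrE lecR nrZ => z1.
by apply: le_trans xM; rewrite ler_piMl ?nr_ge0.
Qed.

Section Several.
Variables (V : normedModType C) (n : nat).
Implicit Types (f : V -> 'rV[C]_n) (z v : V).

Lemma schwarz_slice (E : set 'rV[C]_n) f z v (rho r : R) : convexr E -> balanced E ->
  (forall t : C, nr t < rho -> E (f (z + t *: v)) /\ differentiable f (z + t *: v)) ->
  0 < r < rho -> closure E (r%:C%C *: 'd f z v).
Proof.
move=> cE bE fE rr; have rho0 : 0 < rho by case/andP: rr; apply: lt_trans.
have [|_ d0] := @slice_diff V _ f z v 0.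
  by have [|] := fE 0; rewrite ?nr0.
rewrite scale0r addr0 in d0; rewrite -d0.
apply: (schwarz_convex (rho := rho) cE bE) => // t tr.
have [Et dt] := fE t tr; split => //.
by have [] := slice_diff dt.
Qed.

(** The Schwarz lemma with the closed ball of radius [M] as convex balanced set, along the disc of
    radius [c / nr v] in the direction [v]. *)
Lemma cauchy_estimate f z v (M c : R) : 0 < c ->
  (forall y, nr (y - z) < c -> nr (f y) <= M /\ differentiable f y) ->
  nr ('d f z v) <= M / c * nr v.
Proof.
move=> c0 fM.
have [->|v0] := eqVneq v 0; first by rewrite linear0 !nr0 mulr0.
have nv : 0 < nr v by rewrite lt_neqAle eq_sym nr_eq0 v0 nr_ge0.
have ft (t : C) : nr t < c / nr v -> nr (f (z + t *: v)) <= M /\ differentiable f (z + t *: v).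
  by rewrite ltr_pdivlMr// -nrZ => h; apply: fM; rewrite addrC addKr.
have rM (r : R) : 0 < r < c / nr v -> r * nr ('d f z v) <= M.
  move=> rr; have := schwarz_slice (@ball_convexr n M) (@ball_balanced n M) ft rr.
  move=> /closure_nr cl; apply/ler_addgt0Pr => e e0; have [y /= yM yx] := cl _ e0.
  have r0 : 0 <= r by case/andP: rr => /ltW.
  rewrite -(ger0_norm r0) -nr_real -nrZ -[X in nr X](subrK y).
  by apply: le_trans (nrD _ _) _; rewrite addrC lerD// nrBC ltW.
have M0 : 0 <= M.
  have [|h _] := fM z; first by rewrite subrr nr0.
  by apply: le_trans h; exact: nr_ge0.
rewrite -ler_pdivrMr// ler_pdivlMr// mulrAC -mulrA.
apply/ler_addgt0Pr => e e0.
have [->|D0] := eqVneq ('d f z v) 0; first by rewrite nr0 mul0r addr_ge0// ltW.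
set D := nr _; have Dp : 0 < D by rewrite lt_neqAle eq_sym nr_eq0 D0 nr_ge0.
(* A radius that misses [c / nr v] by at most [e / D]; the second argument keeps it positive. *)
pose r := Num.max (c / nr v - e / D) (c / nr v / 2).
have cv : 0 < c / nr v by rewrite divr_gt0.
have rr : 0 < r < c / nr v.
  rewrite lt_max gt_max; apply/andP; split; first by rewrite divr_gt0 ?orbT.
  by rewrite ltrBlDr ltrDl divr_gt0//= ltr_pdivrMr// ltr_pMr// ltr1n.
have := rM r rr; rewrite -/D => H.
have : (c / nr v - e / D) * D <= M.
  by apply: le_trans H; rewrite ler_pM2r// le_max lexx.
by rewrite mulrBl mulfVK ?gt_eqF// lerBlDr mulrC.
Qed.

(** In the ball of radius [c + c], every point of the segment from [z] to [z + v] is the centre of a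
    ball of radius [c], as the Cauchy estimate requires. *)
Lemma lipschitz_estimate f z v (M c : R) : 0 < c ->
  (forall y, nr (y - z) < c + c -> nr (f y) <= M /\ differentiable f y) ->
  nr v < c -> nr (f (z + v) - f z) <= M / c * nr v.
Proof.
move=> c0 fM vc.
have := @mean_value_ineq _ (fun t : C => f (z + t *: v)) (M / c * nr v).
rewrite scale1r scale0r addr0; apply => t /andP[t0 t1].
have tv : nr (t%:C%C *: v) < c.
  by rewrite nrZ nr_real ger0_norm//; apply: le_lt_trans vc; rewrite ler_piMl ?nr_ge0.
have [d1 d2] : differentiable f (z + t%:C%C *: v) /\ nr ('d f (z + t%:C%C *: v) v) <= M / c * nr v.
  split.
    have [|//] := fM (z + t%:C%C *: v) _.
    by rewrite addrC addKr; move: tv c0; clear; lra.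
  apply: cauchy_estimate => // y yz; apply: fM.
  apply: le_lt_trans (nr_tri _ (z + t%:C%C *: v) _) _.
  by rewrite ltrD// addrC addKr.
by have [h1 h2] := slice_diff d1; rewrite h2.
Qed.

(** No second derivative is formed. The derivative of [u] at [t] is that of the difference
    [g y = f (y + t v) - f y] at [z], applied to [v]; the Lipschitz estimate bounds [g] by a
    multiple of [nr v], and the Cauchy estimate for [g] supplies the second factor. The radius [3 c]
    is [c] for [y] plus the [2 c] that the Lipschitz estimate uses around [y]. *)
Lemma taylor_estimate f z v (M c : R) : 0 < c ->
  (forall y, nr (y - z) < c + c + c -> nr (f y) <= M /\ differentiable f y) ->
  nr v < c -> nr (f (z + v) - f z - 'd f z v) <= M / c / c * nr v ^+ 2.
Proof.
move=> c0 fM vc; have vc3 : nr v < c + c + c by move: vc c0; clear; lra.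
pose u (t : C) := f (z + t *: v) - t *: 'd f z v.
have -> : f (z + v) - f z - 'd f z v = u 1 - u 0.
  by rewrite /u !scale1r !scale0r addr0 subr0 addrAC.
apply: mean_value_ineq => t /andP[t0 t1].
have tv : nr (t%:C%C *: v) <= nr v.
  by rewrite nrZ nr_real ger0_norm// ler_piMl ?nr_ge0.
have tc : nr (t%:C%C *: v) < c by apply: le_lt_trans vc.
have fz y : nr (y - z) < c -> differentiable f y.
  by move=> yz; have [|//] := fM y; move: yz c0; clear; lra.
have dft : differentiable f (z + t%:C%C *: v) by apply: fz; rewrite addrC addKr.
have [h1 h2] := slice_diff dft.
have [i1 i2] := scalel_diff ('d f z v) (t%:C%C : C).
have [e1 e2] := sub_diff h1 i1.
split; first exact: e1.
have -> : 'd u (t%:C%C : C) (1 : C) = 'd f (z + t%:C%C *: v) v - 'd f z v.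
  exact: (etrans (e2 (1 : C)) (f_equal2 (fun a b => a - b) h2 i2)).
pose g y := f (y + t%:C%C *: v) - f y.
have dg y : nr (y - z) < c -> nr (g y) <= M / c * nr v /\ differentiable g y /\
    'd g y v = 'd f (y + t%:C%C *: v) v - 'd f y v.
  move=> yz; have dfy := fz y yz.
  have dfy2 : differentiable f (y + t%:C%C *: v).
    have [|//] := fM (y + t%:C%C *: v) _; rewrite addrAC.
    by apply: le_lt_trans (nrD _ _) _; move: tc yz c0; clear; lra.
  split.
    apply: le_trans (_ : M / c * nr (t%:C%C *: v) <= _).
      apply: lipschitz_estimate => // x xy; apply: fM.
      by apply: le_lt_trans (nr_tri _ y _) _; rewrite ltrD.
    rewrite ler_wpM2l// divr_ge0 ?(ltW c0)//.
    have [|h _] := fM z; first by rewrite subrr nr0 !addr_gt0.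
    by apply: le_trans h; exact: nr_ge0.
  have [k1 k2] := shift_diff dfy2; have [k3 k4] := sub_diff k1 dfy.
  split; first exact: k3.
  exact: (etrans (k4 v) (f_equal (fun a => a - 'd f y v) (k2 v))).
have gM : nr ('d g z v) <= M / c * nr v / c * nr v.
  apply: (@cauchy_estimate g z v (M / c * nr v) c c0) => y yz.
  by have [h3 [h4 _]] := dg y yz; exact: conj h3 h4.
have [_ [_ <-]] := dg z ltac:(by rewrite subrr nr0).
apply: le_trans gM _.
by rewrite le_eqVlt; apply/orP; left; apply/eqP; ring.
Qed.

End Several.

(* The Cayley transform m of g = 1 - f satisfies |m| <= 1 and m 0 = 0, whence
   |m 1| <= 1/4 by the Lipschitz estimate. *)
Lemma harnack (f : C -> C) :
  (forall z, nr z < 8 -> nr (f z) < 1 /\ differentiable f z) ->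
  nr (1 - f 1) <= 3 * nr (1 - f 0).
Proof.
move=> fP; pose g z := 1 - f z.
have Reg z : nr z < 8 -> 0 < complex.Re (g z).
  move=> /fP[f1 _]; rewrite raddfB/= subr_gt0; apply: le_lt_trans f1.
  exact: le_trans (ler_norm _) (nr_Re _).
have n0 : nr (0 : C) < 8 by rewrite nr0.
pose g0 := g 0; have g00 := Reg 0 n0; rewrite -/g0 in g00.
have den z : nr z < 8 -> g z + (g0)^*%C != 0.
  move=> /Reg gz; apply/eqP => /(congr1 (@complex.Re R)); rewrite raddfD/=.
  by case: (g0) g00 => a b /=; move: gz => /=; lra.
pose m z := (g z - g0) * (g z + (g0)^*%C)^-1.
have dgz z : nr z < 8 -> differentiable g z.
  move=> /fP[_ dz]; exact: (differentiableB (differentiable_cst _ _) dz).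
have dm z : nr z < 8 -> differentiable m z.
  move=> z8; apply: differentiable_mul.
    exact: (differentiableB (dgz z z8) (differentiable_cst _ _)).
  apply: differentiable_inv; last exact: den.
  exact: (differentiableD (dgz z z8) (differentiable_cst _ _)).
have m1 z : nr z < 8 -> nr (m z) <= 1.
  move=> z8; rewrite nrM nrV ler_pdivrMr; last first.
    by rewrite lt_neqAle eq_sym nr_eq0 den// nr_ge0.
  rewrite mul1r !nr_def ler_wsqrtr//.
  have := Reg _ z8; case: (g z) => a b /=; case: (g0) g00 => a0 b0 /= h1 h2.
  have : 0 <= a * a0 by rewrite mulr_ge0// ltW.
  by clear; nra.
pose F (z : C) : 'rV[C]_1 := m z *: const_mx 1.
have dF z : nr z < 8 -> differentiable F z.
  move=> /dm dmz; have [dk _] := scalel_diff (const_mx 1 : 'rV[C]_1) (m z).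
  exact: (differentiable_comp dmz dk).
have F1 z : nr z < 8 -> nr (F z) <= 1.
  move=> /m1 mz; apply: nr_matrix_le => // i j.
  by rewrite !mxE mulr1.
have m0 : m 0 = 0 by rewrite /m subrr mul0r.
(* The radius 8 is [c + c] for [c = 4]. *)
have mm : nr (m 1) <= 4^-1.
  have H : nr (F (0 + 1) - F 0) <= 1 / 4 * nr (1 : C).
    apply: lipschitz_estimate => //; last by rewrite nr1; clear; lra.
    move=> y; rewrite subr0 => y8.
    have {}y8 : nr y < 8 by move: y8; move: (nr y) => a; clear; lra.
    by split; [exact: F1|exact: dF].
  rewrite add0r nr1 mulr1 div1r in H; apply: le_trans H.
  apply: le_trans (nr_entry _ 0 0); rewrite !mxE m0 mul0r subr0 mulr1.
  exact: lexx.
have n1 : nr (1 : C) < 8 by rewrite nr1 ltr1n.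
(* This solves the definition of [m 1] for [g 1]; with [|m 1| <= 1/4] the ratio of [|g 1|] to
   [|g 0|] is at most (5/4) / (3/4), hence below 3. *)
have e1 : g 1 * (1 - m 1) = g0 + m 1 * (g0)^*%C.
  by rewrite /m; field; exact: den.
have e2 : nr (g 1) * nr (1 - m 1) <= nr g0 + nr (m 1) * nr g0.
  rewrite -nrM e1; apply: le_trans (nrD _ _) _; rewrite nrM lerD2l.
  by rewrite !nr_def; case: (g0) => a b /=; rewrite sqrrN.
have e3 : 1 - nr (m 1) <= nr (1 - m 1).
  rewrite lerBlDr -[leLHS](@nr1 R) -[X in nr X <= _](subrK (m 1)); exact: nrD.
rewrite -/(g 1) -/(g 0) -/g0.
have := nr_ge0 (g 1); have := nr_ge0 g0; move: mm e2 e3.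
by move: (nr _) (nr _) (nr _) (nr _) => a1 a2 a3 a4; clear; nra.
Qed.

End Estimates.

(** * Compactness *)

Section Compactness.
Variable R : realType.
Local Notation C := R[i].

Lemma ultra_limit (U : set_system nat) (u : nat -> R) (M : R) : UltraFilter U ->
  (forall k, `|u k| <= M) ->
  exists l, forall e, 0 < e -> U [set k | `|u k - l| < e].
Proof.
move=> UU uM.
have [|l [_ lcl]] := @segment_compact R (- M) M (u @ U) _.
  apply: (@filterE nat U) => k /=; rewrite in_itv/=.
  by have := uM k; rewrite ler_norml.
exists l => e e0; have [//|nU] := in_ultra_setVsetC [set k | `|u k - l| < e] UU.
have := lcl (u @` ~` [set k | `|u k - l| < e]) (ball l e) _ _.
case; [|exact: nbhsx_ballx|].
  by apply: (@filterS nat U) nU => k nk; exists k.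
by move=> _ [[k nk <-]]; rewrite -ball_normE/= distrC.
Qed.

(** Along an ultrafilter that refines the filter at infinity, all real and imaginary parts of the
    entries converge at once, without successive extraction of subsequences. *)
Lemma bolzano_weierstrass_mx m n (u : nat -> 'M[C]_(m, n)) (M : R) :
  (forall k, nr (u k) <= M) ->
  exists l, forall e, 0 < e -> forall k0, exists2 k, (k0 <= k)%N & nr (u k - l) < e.
Proof.
move=> uM; have [U [UU Uoo]] := ultraFilterLemma (F := \oo) _.
have reM i j : exists l, forall e, 0 < e -> U [set k | `|complex.Re (u k i j) - l| < e].
  apply: (ultra_limit (M := M)) => k; apply: le_trans (uM k).
  exact: le_trans (nr_Re _) (nr_entry _ _ _).
have imM i j : exists l, forall e, 0 < e -> U [set k | `|complex.Im (u k i j) - l| < e].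
  apply: (ultra_limit (M := M)) => k; apply: le_trans (uM k).
  exact: le_trans (nr_Im _) (nr_entry _ _ _).
pose a i j := projT1 (cid (reM i j)); pose b i j := projT1 (cid (imM i j)).
exists (\matrix_(i, j) (a i j +i* b i j)%C) => e e0 k0.
have e4 : 0 < e / 4 by rewrite divr_gt0.
have FU : ProperFilter U by exact: ultra_proper.
have : U [set k | (k0 <= k)%N /\ forall ij : 'I_m * 'I_n,
    `|complex.Re (u k ij.1 ij.2) - a ij.1 ij.2| < e / 4 /\
    `|complex.Im (u k ij.1 ij.2) - b ij.1 ij.2| < e / 4].
  apply: filterI; first by apply: Uoo; exists k0.
  apply: (@filter_forall _ _ (fun ij k => `|complex.Re (u k ij.1 ij.2) - a ij.1 ij.2| < e / 4 /\
    `|complex.Im (u k ij.1 ij.2) - b ij.1 ij.2| < e / 4)) => -[i j] /=.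
  apply: filterI.
    by rewrite /a; case: cid => l /= /(_ _ e4).
  by rewrite /b; case: cid => l /= /(_ _ e4).
move=> /filter_ex[k [k0k kP]]; exists k => //.
apply: le_lt_trans (_ : e / 2 < e); last by move: e0; clear; lra.
apply: nr_matrix_le => [|i j]; first by move: e0; clear; lra.
apply: le_trans (nr_le_ReIm _) _; have [/ltW h1 /ltW h2] := kP (i, j).
rewrite !mxE; case: (u k i j) h1 h2 => x y /= h1 h2.
by have := lerD h1 h2; move: (`|_| + _) => t; move: e0; clear; lra.
Qed.

End Compactness.

(** * Scaling in convex and balanced sets *)

Section Geometry.
Variable R : realType.
Local Notation C := R[i].
Variable n : nat.
Implicit Types D E : set 'rV[C]_n.

Lemma convex_set_convexr D : convex_set D -> convexr D.
Proof.
move=> cD x y t /andP[t0 t1] Dx Dy.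
have t0' : 0 <= t%:C%C :> C by rewrite lecR.
have t1' : t%:C%C <= 1 :> C by rewrite lecR.
have := cD y x (Itv01 t0' t1'); rewrite !inE => /(_ Dy Dx).
have -> : (1 - t)%:C%C = 1 - t%:C%C :> C by rewrite rmorphB.
by rewrite addrC.
Qed.

Lemma bounded_set_nr D : bounded_set D -> exists2 M : R, 0 < M & forall x, D x -> nr x <= M.
Proof.
move=> [M [Mr DM]].
have [N [N0 MN]] : exists N : R, 0 < N /\ M < N%:C%C.
  exists (Num.max 1 (complex.Re M + 1)); split; first by rewrite lt_max ltr01.
  rewrite -(RRe_real Mr) ltcR lt_max ltrDl ltr01 orbT//.
exists N => // x Dx; have : `|x| <= N%:C%C := DM _ MN x Dx.
by rewrite nrE lecR.
Qed.

(** [y] is the combination, with weights [1 - r] and [r], of [x] and a point [w] of the ball of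
    radius [e]: the set [r D] has a margin of [(1 - r) * e] inside [D]. *)
Lemma convexr_scale_tube D (e r : R) x y : convexr D -> (forall x, nr x < e -> D x) ->
  0 <= r < 1 -> D x -> nr (y - r%:C%C *: x) < (1 - r) * e -> D y.
Proof.
move=> cD De /andP[r0 r1] Dx yx.
have r1' : 0 < 1 - r by rewrite subr_gt0.
pose w := ((1 - r)^-1)%:C%C *: (y - r%:C%C *: x).
have Dw : D w.
  apply: De; rewrite nrZ nr_real ger0_norm ?invr_ge0 ?(ltW r1')//.
  by rewrite mulrC ltr_pdivrMr// mulrC.
have := cD w x r ltac:(by rewrite r0 ltW) Dw Dx.
rewrite scalerA -rmorphM/= mulfV ?gt_eqF//= scale1r.
by rewrite subrK.
Qed.

Lemma closure_scale D (e s : R) x : convexr D -> 0 < e -> (forall x, nr x < e -> D x) ->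
  0 <= s < 1 -> closure D x -> D (s%:C%C *: x).
Proof.
move=> cD e0 De s01 /closure_nr cl; case/andP: (s01) => s0 s1.
have e1 : 0 < (1 - s) * e by rewrite mulr_gt0// subr_gt0.
have [y Dy yx] := cl _ e1.
apply: (convexr_scale_tube cD De s01 Dy).
rewrite -scalerBr nrZ nr_real ger0_norm// nrBC; apply: le_lt_trans yx.
by rewrite ler_piMl ?nr_ge0// ltW.
Qed.

Lemma balanced_scale D (s t : R) x : balanced D -> 0 <= s <= t -> 0 < t -> D x ->
  exists2 x', D x' & s%:C%C *: x = t%:C%C *: x'.
Proof.
move=> bD /andP[s0 st] t0 Dx; exists ((s / t)%:C%C *: x).
  apply: bD => //; rewrite nrE lecR nr_real ger0_norm ?divr_ge0 ?(ltW t0)//.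
  by rewrite ler_pdivrMr// mul1r.
by rewrite scalerA -rmorphM mulrC mulfVK ?gt_eqF.
Qed.

Lemma open_scale D x : open D -> D x ->
  exists2 r : R, 0 < r < 1 & exists2 x', D x' & x = r%:C%C *: x'.
Proof.
move=> oD Dx; have [d d0 dP] := (open_nr D).1 oD x Dx.
have x1 : 0 < nr x + 1 by rewrite ltr_wpDl ?nr_ge0.
pose h := d / 2 / (nr x + 1); have h0 : 0 < h by rewrite !divr_gt0.
exists (1 + h)^-1.
  by rewrite invr_gt0 invf_lt1 ?ltrDl ?addr_gt0//= h0.
exists ((1 + h)%:C%C *: x); last first.
  by rewrite scalerA -rmorphM mulVf ?scale1r// gt_eqF// addr_gt0.
apply: dP; rewrite rmorphD scalerDl scale1r addrC addKr nrZ nr_real gtr0_norm//.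
rewrite /h -mulrA; apply: le_lt_trans (_ : d / 2 * 1 < d).
  by rewrite ler_pM2l ?divr_gt0// mulrC ler_pdivrMr// mul1r lerDl.
by move: d0; clear; lra.
Qed.

End Geometry.

(** * Attraction to peak points *)

Section LocalPeak.
Variable R : realType.
Local Notation C := R[i].
Variable n : nat.
Local Notation Cn := 'rV[C]_n.
Implicit Types (D E : set Cn) (q : Cn).

(** What Harnack's inequality needs of a peak function, and only on the part of [E] near [q], so
    that a local biholomorphism can transport it. The last two clauses say that, in this part of
    [E], [h z] is close to 1 exactly when [z] is close to [q]. *)
Definition local_peak E q := exists h : Cn -> C, exists2 d0 : R, 0 < d0 &
  [/\ forall z, E z -> nr (z - q) < d0 -> differentiable h z /\ nr (h z) < 1,
      forall d, 0 < d -> exists2 e, 0 < e &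
        forall z, E z -> nr (z - q) < d0 -> nr (1 - h z) < e -> nr (z - q) < d &
      forall e, 0 < e -> exists2 d, 0 < d &
        forall z, E z -> nr (z - q) < d -> nr (1 - h z) < e].

Lemma local_peak_transfer E q E' q' (a b : Cn -> Cn) (d1 : R) : 0 < d1 ->
  local_peak E q ->
  (forall z, E' z -> nr (z - q') < d1 -> [/\ E (a z), differentiable a z & b (a z) = z]) ->
  (forall e, 0 < e -> exists2 d, 0 < d & forall z, nr (z - q') < d -> nr (a z - q) < e) ->
  (forall e, 0 < e -> exists2 d, 0 < d & forall w, nr (w - q) < d -> nr (b w - q') < e) ->
  local_peak E' q'.
Proof.
move=> d10 [h [d0 d00 [h1 h2 h3]]] aP ca cb.
have [d2 d20 a2] := ca _ d00.
have dd : 0 < Num.min d1 d2 by rewrite lt_min d10.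
exists (h \o a); exists (Num.min d1 d2) => //; split.
- move=> z E'z; rewrite lt_min => /andP[z1 z2].
  have [Ea da _] := aP z E'z z1; have [dh hn] := h1 _ Ea (a2 _ z2).
  by split; [exact: (differentiable_comp da dh)|].
- move=> d dp; have [r r0 bP] := cb _ dp; have [e e0 eP] := h2 _ r0.
  exists e => // z E'z; rewrite lt_min => /andP[z1 z2] hz.
  have [Ea da <-] := aP z E'z z1; apply: bP; apply: eP => //; exact: a2.
- move=> e e0; have [r r0 rP] := h3 _ e0; have [d dp aq] := ca _ r0.
  exists (Num.min d1 d) => [|z E'z]; first by rewrite lt_min d10.
  rewrite lt_min => /andP[z1 z2]; have [Ea _ _] := aP z E'z z1.
  by apply: rP => //; exact: aq.
Qed.

(** The Lipschitz estimate keeps [f] within [d0] of [q] near [y], so [h] can be composed with [f]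
    there, and Harnack's inequality bounds the growth of [1 - h] by the factor 3. The step length
    [k] is chosen before [d] and [f], which allows steps to be chained. *)
Lemma attract_step (V : normedModType C) E q (M c : R) : local_peak E q ->
  (forall x, E x -> nr x <= M) -> 0 < c -> exists2 k, 0 < k &
  forall d, 0 < d -> exists2 d', 0 < d' & forall (f : V -> Cn) y,
    (forall x, nr (x - y) < c -> E (f x) /\ differentiable f x) ->
    nr (f y - q) < d' -> forall v, nr v < k -> nr (f (y + v) - q) < d.
Proof.
move=> [h [d0 d00 [h1 h2 h3]]] EM c0.
have [c1 c10 cc] : exists2 c1, 0 < c1 & c = c1 + c1.
  by exists (c / 2); [rewrite divr_gt0|field].
pose L := `|M| / c1 + 1; have L0 : 0 < L by rewrite ltr_wpDl// divr_ge0 ?(ltW c10).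
have [k0 k00 [kc kd]] : exists2 k0, 0 < k0 & k0 <= c1 /\ L * k0 <= d0 / 2.
  exists (Num.min c1 (d0 / 2 / L)); first by rewrite lt_min c10 !divr_gt0.
  split; first by rewrite ge_min lexx.
  by rewrite mulrC -ler_pdivlMr// ge_min lexx orbT.
(* Harnack's inequality uses the disc of radius 8 in the direction [v]. *)
exists (k0 / 8) => [|d dp]; first by rewrite divr_gt0.
have [e e0 eP] := h2 _ dp; have [r r0 rP] := h3 (e / 3) ltac:(by rewrite divr_gt0).
have d02 : 0 < d0 / 2 by rewrite divr_gt0.
exists (Num.min r (d0 / 2)) => [|f y fP]; first by rewrite lt_min r0.
rewrite lt_min => /andP[yr yd] v vk.
have near w : nr w < k0 -> nr (f (y + w) - q) < d0.
  move=> wk; rewrite [d0]splitr; apply: le_lt_trans (nr_tri _ (f y) _) _.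
  apply: ler_ltD => //; apply: le_trans (_ : `|M| / c1 * nr w <= _).
    apply: lipschitz_estimate => //; last by apply: lt_le_trans kc.
    move=> x; rewrite -cc => /fP[Ex dx]; split => //.
    by apply: le_trans (EM _ Ex) _; exact: ler_norm.
  apply: le_trans kd; rewrite ler_pM ?nr_ge0 ?divr_ge0 ?(ltW c10) ?(ltW wk)//.
  by rewrite /L lerDl.
have tv (t : C) : nr t < 8 -> nr (t *: v) < k0.
  move=> t8; rewrite nrZ; apply: le_lt_trans (_ : 8 * nr v < k0).
    by rewrite ler_wpM2r ?nr_ge0// ltW.
  by move: vk; move: (nr v) => a; clear; lra.
have tE (t : C) : nr t < 8 -> E (f (y + t *: v)) /\ differentiable f (y + t *: v).
  move=> /tv t8; apply: fP; rewrite addrC addKr; apply: lt_le_trans t8 _.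
  by rewrite cc; move: kc c10; clear; lra.
have := @harnack R (fun t => h (f (y + t *: v))).
rewrite scale1r scale0r addr0 => H.
have n8 : nr (1 : C) < 8 by rewrite nr1 ltr1n.
have {}H : nr (1 - h (f (y + v))) <= 3 * nr (1 - h (f y)).
  apply: H => t t8; have [Et dt] := tE t t8.
  have [dh hn] := h1 _ Et (near _ (tv _ t8)); split => //.
  have [ds _] := slice_diff dt.
  exact: (differentiable_comp ds dh).
have [Ev _] := tE 1 n8; rewrite scale1r in Ev.
have nv := near _ (tv 1 n8); rewrite scale1r in nv.
apply: eP => //; apply: le_lt_trans H _.
have [Ey _] := fP y ltac:(by rewrite subrr nr0).
have := rP _ Ey yr; move: (nr _) => a; clear; lra.
Qed.

Lemma attract_chain (V : normedModType C) E q (M c : R) : local_peak E q ->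
  (forall x, E x -> nr x <= M) -> 0 < c -> exists2 k, 0 < k &
  forall (N : nat) d, 0 < d -> exists2 d', 0 < d' & forall (f : V -> Cn) y v,
    (forall j x, (j <= N)%N -> nr (x - (y + j%:R *: v)) < c -> E (f x) /\ differentiable f x) ->
    nr v < k -> nr (f y - q) < d' -> nr (f (y + N%:R *: v) - q) < d.
Proof.
move=> Eq EM c0; have [k k0 kP] := attract_step V Eq EM c0.
exists k => //; elim=> [|N IH] d d0.
  by exists d => // f y v _ _; rewrite scale0r addr0.
have [d1 d10 d1P] := kP _ d0; have [d2 d20 d2P] := IH _ d10.
exists d2 => // f y v fP vk yd.
rewrite -natr1 scalerDl scale1r addrA; apply: d1P => //.
  by move=> x; apply: fP; rewrite leqnSn.
by apply: d2P => // j x jN; apply: fP; rewrite (leq_trans jN).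
Qed.

(** The segment from [r y] to [r z] has a tube of width [(1 - r) * e] in [D], so it can be followed
    in [N] steps of length below [k]. [N] depends only on the bound for [D], which makes [d']
    uniform in [f], [y] and [z]. *)
Lemma attraction D E q (M M' e r : R) : local_peak E q ->
  (forall x, E x -> nr x <= M) -> convexr D -> 0 < e -> (forall x, nr x < e -> D x) ->
  (forall x, D x -> nr x <= M') -> 0 <= r < 1 ->
  forall d, 0 < d -> exists2 d', 0 < d' & forall f : Cn -> Cn,
    (forall x, D x -> E (f x) /\ differentiable f x) ->
    forall y z, D y -> D z -> nr (f (r%:C%C *: y) - q) < d' -> nr (f (r%:C%C *: z) - q) < d.
Proof.
move=> Eq EM cD e0 De DM r01 d d0; case/andP: (r01) => r0 r1.
have c0 : 0 < (1 - r) * e by rewrite mulr_gt0// subr_gt0.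
have [k k0 kP] := attract_chain Cn Eq EM c0.
have M'0 : 0 <= M' by apply: le_trans (DM 0 _); rewrite ?nr_ge0//; apply: De; rewrite nr0.
pose N := (Num.truncn (2 * M' / k)).+1.
have NM : 2 * M' < k * N%:R.
  by rewrite [k * _]mulrC -ltr_pdivrMr// truncnS_gt.
have N0 : 0 < N%:R :> R by rewrite ltr0n.
have NC : N%:R != 0 :> C by rewrite pnatr_eq0.
have [d' d'0 d'P] := kP N _ d0; exists d' => // f fP y z Dy Dz yd.
pose v := N%:R^-1 *: (r%:C%C *: z - r%:C%C *: y).
have -> : r%:C%C *: z = r%:C%C *: y + N%:R *: v.
  by rewrite /v scalerA mulfV// scale1r addrC subrK.
apply: d'P => //; last first.
  rewrite nrZ nrV nr_nat mulrC ltr_pdivrMr// -scalerBr nrZ nr_real ger0_norm//.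
  apply: le_lt_trans NM; apply: le_trans (_ : nr (z - y) <= _).
    by rewrite ler_piMl ?nr_ge0// ltW.
  by apply: le_trans (nrB _ _) _; have := DM _ Dy; have := DM _ Dz; move: (nr _) (nr _) => a b; clear; lra.
move=> j x jN xj; apply: fP.
have jN1 : 0 <= (j%:R / N%:R : R) <= 1.
  by rewrite divr_ge0//= ler_pdivrMr// mul1r ler_nat.
have Dj := cD _ _ _ jN1 Dy Dz.
apply: (convexr_scale_tube cD De r01 Dj).
move: xj; congr (nr (_ - _) < _); rewrite /v.
have -> : ((j%:R / N%:R : R)%:C)%C = j%:R * N%:R^-1 :> C.
  by rewrite rmorphM fmorphV/= !rmorph_nat.
have -> : ((1 - (j%:R / N%:R : R))%:C)%C = 1 - j%:R * N%:R^-1 :> C.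
  by rewrite rmorphB rmorphM fmorphV/= !rmorph_nat.
by apply/rowP => l; rewrite !mxE; ring.
Qed.

(** Only the second clause takes work. A sequence in [D] on which [h] tends to 1 while staying away
    from [q] would have a cluster point in the closure, different from [q], where [h] equals 1. *)
Lemma peak_local_peak D q (M : R) : open D -> (forall x, D x -> nr x <= M) ->
  peak_point D q -> local_peak D q.
Proof.
move=> oD DM [[cq iq] [h [[_ dh] ch hq hlt]]].
have Dq : ~ D q by move=> Dq; apply: iq; move: oD; rewrite openE; exact.
have ch' x : closure D x -> forall e, 0 < e -> exists2 d, 0 < d &
    forall y, closure D y -> nr (y - x) < d -> nr (h y - h x) < e.
  move=> Dx e e0; have /subspace_continuousP /(_ _ Dx) := ch.
  move=> /cvgrPdist_lt /(_ e%:C%C); rewrite ltcR => /(_ e0).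
  move=> /near_nr[d d0 dP]; exists d => // y Dy yx.
  by have := dP y yx Dy; rewrite nrE ltcR nrBC.
have lt1 z : D z -> nr (h z) < 1.
  move=> Dz; have := hlt z (subset_closure Dz) _.
  by rewrite nrE -[1]/(1%:C%C) ltcR; apply => zq; apply: Dq; rewrite -zq.
exists h; exists 1; first exact: ltr01.
split.
- by move=> z Dz _; split; [exact: dh|exact: lt1].
- move=> d d0; apply: contrapT => no.
  have no' k : exists z, [/\ D z, nr (1 - h z) < k.+1%:R^-1 & d <= nr (z - q)].
    apply: contrapT => nz; apply: no; exists k.+1%:R^-1; first by rewrite invr_gt0.
    move=> z Dz _ hz; rewrite ltNge; apply/negP => zd; apply: nz; by exists z.
  pose u k := projT1 (cid (no' k)).
  have uP k : [/\ D (u k), nr (1 - h (u k)) < k.+1%:R^-1 & d <= nr (u k - q)].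
    by rewrite /u; case: cid.
  have uM k : nr (u k) <= M by apply: DM; have [] := uP k.
  have [l lP] := bolzano_weierstrass_mx uM.
  have cl : closure D l.
    apply/closure_nr => e e0; have [k _ kl] := lP e e0 0%N.
    by exists (u k) => //; have [] := uP k.
  have lq : l <> q.
    move=> lq; have [k _] := lP d d0 0%N; rewrite lq ltNge.
    by have [_ _ ->] := uP k.
  have hl : h l = 1.
    apply/eqP; rewrite eq_sym -subr_eq0 -nr_eq0 eq_le nr_ge0 andbT.
    apply/ler_addgt0Pr => e e0; rewrite add0r.
    have e2 : 0 < e / 2 by rewrite divr_gt0.
    have [r r0 rP] := ch' l cl _ e2.
    pose k0 := Num.truncn (e / 2)^-1.
    have [k kk kl] := lP r r0 k0; have [Du hu _] := uP k.
    have := rP _ (subset_closure Du) kl => h2.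
    have h3 : (k.+1%:R^-1 : R) <= e / 2.
      rewrite -[leRHS]invrK lef_pV2 ?posrE ?invr_gt0//.
      apply: le_trans (_ : k0.+1%:R <= _); first by rewrite ltW// truncnS_gt.
      by rewrite ler_nat.
    rewrite [e]splitr; apply: le_trans (nr_tri _ (h (u k)) _) _.
    by rewrite lerD// ?(ltW h2)// ltW// (lt_le_trans hu).
  by have := hlt l cl lq; rewrite hl normr1 ltxx.
- move=> e e0; have [d d0 dP] := ch' q cq _ e0; exists d => // z Dz zq.
  have := dP z (subset_closure Dz) zq; by rewrite hq nrBC.
Qed.

End LocalPeak.

(** * Approximate homogeneity of symmetric domains *)

Section Homogeneity.
Variable R : realType.
Local Notation C := R[i].
Variable n : nat.
Local Notation Cn := 'rV[C]_n.
Implicit Types (D E G : set Cn) (f g : Cn -> Cn).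

Definition inverse_pair D E f g :=
  (forall x, D x -> [/\ E (f x), differentiable f x & g (f x) = x]) /\
  (forall y, E y -> [/\ D (g y), differentiable g y & f (g y) = y]).

Lemma inverse_pair_id D : inverse_pair D D id id.
Proof. by split=> x Dx; split => //; exact: differentiable_id. Qed.

Lemma inverse_pair_comp D E G f g f' g' : inverse_pair D E f g ->
  inverse_pair E G f' g' -> inverse_pair D G (f' \o f) (g \o g').
Proof.
move=> [fP gP] [f'P g'P]; split=> x.
  move=> /fP[Ef df gf]; have [Gf df' gf'] := f'P _ Ef.
  split; [exact: Gf|exact: (differentiable_comp df df')|].
  exact: etrans (f_equal g gf') gf.
move=> /g'P[Ef df gf]; have [Gf df' gf'] := gP _ Ef.
split; [exact: Gf|exact: (differentiable_comp df df')|].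
exact: etrans (f_equal f' gf') gf.
Qed.

Lemma biholomorphic_inverse_pair D E f : biholomorphic D E f ->
  exists g, inverse_pair D E f g.
Proof.
move=> [[_ df] fDE [g [[_ dg] gf]]]; exists g; split=> x.
  by move=> Dx; split; [rewrite -fDE; exists x|exact: df|exact: gf].
by rewrite -fDE => -[y Dy <-]; rewrite gf//; split => //; apply: dg; rewrite -fDE; exists y.
Qed.

Lemma inverse_pair_biholomorphic D E f g : open D -> open E ->
  inverse_pair D E f g -> biholomorphic D E f.
Proof.
move=> oD oE [fP gP]; split.
- by split => // z /fP[].
- apply/seteqP; split=> [_ [x /fP[Ex _ _] <-]//|y /gP[Dg _ fg]].
  by exists (g y).
- by exists g; split; [split => // z /gP[]|move=> z /fP[]].
Qed.

(** The symmetry of [B] at [g m], conjugated by [f]. *)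
Lemma realization_symmetry D : bounded_symmetric_domain_realization D ->
  forall m, D m -> exists s, [/\ inverse_pair D D s s, s m = m &
    exists2 e : R, 0 < e & forall z, D z -> nr (z - m) < e -> s z = z -> z = m].
Proof.
move=> [_ [B [[_ [g0 [[_ _ symB] _]]] [f /biholomorphic_inverse_pair[g [fP gP]]]]]] m Dm.
have [Bm dgm fgm] := gP _ Dm.
have [s [[/biholomorphic_inverse_pair[s' sP] _] ss sm siso]] := symB _ Bm.
have sP2 : inverse_pair B B s s.
  split=> x Bx; have [Bsx dsx _] := sP.1 x Bx; split => //; exact: ss.
exists (f \o (s \o g)); split.
- have := inverse_pair_comp (inverse_pair_comp (conj gP fP) sP2) (conj fP gP).
  by [].
- by rewrite /= sm.
- have [e e0 eP] := (near_nr _ _).1 siso.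
  have [d d0 dP] := differentiable_nr dgm e0.
  exists d => // z Dz zm /= fs; have [Bz _ fgz] := gP _ Dz.
  have [Bs _ gfs] := fP _ (let: And3 a _ _ := sP2.1 _ Bz in a).
  rewrite -fgz -fgm; congr f; apply: eP; first exact: dP.
  by rewrite -[LHS]gfs fs.
Qed.

(* One step of the iteration of midpoints of z and s z, which converges
   quadratically to a fixed point of s. *)
Lemma involution_step (D : set Cn) (s : Cn -> Cn) (m z : Cn) (M c : R) : 0 < c ->
  (forall x, D x -> nr x <= M) -> inverse_pair D D s s ->
  (forall x, nr (x - m) < c + c + c + c -> D x) ->
  nr (z - m) < c -> nr (s z - z) < c ->
  nr (s (z + 2^-1 *: (s z - z)) - (z + 2^-1 *: (s z - z))) <= M / c / c * nr (s z - z) ^+ 2.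
Proof.
move=> c0 DM [sP _] Dm zm wc; set w := s z - z.
have zM y : nr (y - z) < c + c + c -> nr (s y) <= M /\ differentiable s y.
  move=> yz; have /sP[Ds ds _] : D y.
    apply: Dm; apply: le_lt_trans (nr_tri _ z _) _.
    by rewrite ltrD.
  by split => //; exact: DM.
have K0 : 0 <= M / c / c.
  have [h _] := zM z ltac:(by rewrite subrr nr0 !addr_gt0).
  by rewrite !divr_ge0 ?(ltW c0)//; apply: le_trans h; exact: nr_ge0.
have w2 : nr (2^-1 *: w) = 2^-1 * nr w by rewrite nrZ nrV nr_nat.
have h1 := taylor_estimate c0 zM wc.
have h2 := @taylor_estimate R _ _ _ _ (2^-1 *: w) _ _ c0 zM.
have {}h2 := h2 ltac:(rewrite w2; apply: le_lt_trans wc; rewrite ler_piMl ?nr_ge0//; clear; lra).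
rewrite -/w in h1; have Dz : D z.
  by apply: Dm; apply: (lt_trans zm); move: c0; clear; lra.
have [_ _ ssz] := sP _ Dz.
(* Since [z + w = s z] and [s] is an involution, [h1] becomes the expansion of [s (s z) = z] at
   [z]. *)
rewrite {2}/w (addrC z) subrK ssz in h1.
rewrite linearZ/= in h2.
(* Half of ['d s z w] occurs in both Taylor remainders and cancels; they contribute one quarter and
   one half of the bound. *)
have -> : s (z + 2^-1 *: w) - (z + 2^-1 *: w) =
   (s (z + 2^-1 *: w) - s z - 2^-1 *: 'd s z w) - 2^-1 *: (z - s z - 'd s z w).
  have -> : s z = z + w by rewrite addrC subrK.
  move: (s _) ('d s z w) => a d.
  by apply/rowP => j; rewrite !mxE; field.
apply: le_trans (nrB _ _) _; rewrite nrZ nrV nr_nat.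
rewrite w2 exprMn in h2.
have i20 : 0 <= 2^-1 :> R by rewrite invr_ge0.
apply: le_trans (lerD h2 (ler_wpM2l i20 h1)) _.
have : 0 <= M / c / c * nr w ^+ 2 by rewrite mulr_ge0// sqr_ge0.
rewrite [_ * (2^-1 ^+ 2 * _)]mulrCA expr2; move: (_ / c / c * _) => x; clear.
lra.
Qed.

(** The bound 1/2 turns the quadratic decrease of the displacement [s u - u] into a halving. The
    iterates then stay within [w] of [z], and any cluster point is fixed because the displacements
    tend to 0. *)
Lemma involution_fixpoint (D : set Cn) (s : Cn -> Cn) (m z : Cn) (M c : R) : 0 < c ->
  (forall x, D x -> nr x <= M) -> inverse_pair D D s s ->
  (forall x, nr (x - m) < c + c + c + c -> D x) ->
  nr (z - m) + nr (s z - z) < c ->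
  M / c / c * nr (s z - z) <= 2^-1 ->
  exists2 l, s l = l & nr (l - z) <= nr (s z - z).
Proof.
move=> c0 DM ip Dm zc Kw; set K := M / c / c; set w := nr (s z - z).
have w0 : 0 <= w by exact: nr_ge0.
pose st x := x + 2^-1 *: (s x - x).
pose u k := iter k st z.
have uS k : nr (u k.+1 - u k) = 2^-1 * nr (s (u k) - u k).
  by rewrite /u/= /st addrC addKr nrZ nrV nr_nat.
have uP k : [/\ nr (s (u k) - u k) <= w * 2^-1 ^+ k & nr (u k - z) <= w * (1 - 2^-1 ^+ k)].
  elim: k => [|k [h1 h2]]; first by rewrite expr0 mulr1 !subrr nr0 mulr0.
  have ek : 0 < 2^-1 ^+ k :> R by rewrite exprn_gt0.
  have e1 : 2^-1 ^+ k <= 1 :> R by apply: exprn_ile1; clear; lra.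
  have h3 : nr (s (u k) - u k) <= w by apply: le_trans h1 _; rewrite ler_piMr.
  have uz : nr (u k - z) <= w by apply: le_trans h2 _; rewrite ler_piMr// gerBl ltW.
  have um : nr (u k - m) < c.
    apply: le_lt_trans zc; apply: le_trans (nr_tri _ z _) _.
    by rewrite addrC lerD.
  have wc : nr (s (u k) - u k) < c.
    apply: le_lt_trans h3 _; apply: le_lt_trans zc; rewrite -/w.
    by rewrite lerDr nr_ge0.
  have h4 := involution_step c0 DM ip Dm um wc.
  split.
    apply: le_trans h4 _; rewrite expr2 mulrA.
    apply: le_trans (_ : 2^-1 * (w * 2^-1 ^+ k) <= _); last by rewrite exprS mulrCA.
    apply: ler_pM; rewrite ?nr_ge0//.
      rewrite mulr_ge0 ?nr_ge0// !divr_ge0 ?(ltW c0)//.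
      have Dmm : D m by apply: Dm; rewrite subrr nr0 !addr_gt0.
      by apply: le_trans (DM _ Dmm); exact: nr_ge0.
    apply: le_trans Kw; rewrite -/K -/w ler_wpM2l//.
    rewrite /K !divr_ge0 ?(ltW c0)//.
    have Dmm : D m by apply: Dm; rewrite subrr nr0 !addr_gt0.
    by apply: le_trans (DM _ Dmm); exact: nr_ge0.
  apply: le_trans (nr_tri _ (u k) _) _; rewrite uS exprS.
  by move: h1 h2; move: (nr _) (nr _) (2^-1 ^+ k) => a b x; clear; lra.
have Du k : D (u k).
  have [_ h2] := uP k; apply: Dm; apply: le_lt_trans (nr_tri _ z _) _.
  have ek : 0 < 2^-1 ^+ k :> R by rewrite exprn_gt0.
  have uz : nr (u k - z) <= w by apply: le_trans h2 _; rewrite ler_piMr// gerBl ltW.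
  by move: uz zc c0; rewrite -/w; move: (nr _) (nr _) => a b; clear; lra.
have [l lP] := bolzano_weierstrass_mx (fun k => DM _ (Du k)).
have lz : nr (l - z) <= w.
  apply/ler_addgt0Pr => e e0; have [k _ kl] := lP e e0 0%N.
  apply: le_trans (nr_tri _ (u k) _) _; rewrite addrC lerD//; last by rewrite nrBC ltW.
  have [_ h2] := uP k; apply: le_trans h2 _.
  by rewrite ler_piMr// gerBl exprn_ge0.
exists l => //; apply/eqP; rewrite -subr_eq0 -nr_eq0 eq_le nr_ge0 andbT.
have Dl : D l.
  apply: Dm; apply: le_lt_trans (nr_tri _ z _) _.
  by move: lz zc c0; rewrite -/w; move: (nr _) (nr _) => a b; clear; lra.
have [_ dsl _] := ip.1 l Dl.
apply/ler_addgt0Pr => e e0; rewrite add0r.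
have e3 : 0 < e / 3 by rewrite divr_gt0.
have [r r0 rP] := differentiable_nr dsl e3.
have w1 : 0 < w + 1 by rewrite ltr_wpDl.
have [k0 k0P] := half_pow_lt (divr_gt0 e3 w1).
have [k kk0 kl] := lP (Num.min r (e / 3)) ltac:(by rewrite lt_min r0) k0.
move: kl; rewrite lt_min => /andP[/rP kr ke].
have [wk _] := uP k; have := k0P k kk0; rewrite /= ltr_pdivlMr// => ek.
have wk3 : nr (s (u k) - u k) <= e / 3.
  apply: le_trans wk _; apply: le_trans (ltW ek).
  by rewrite mulrC ler_wpM2l ?exprn_ge0// lerDl.
have -> : e = e / 3 + e / 3 + e / 3 by field.
apply: le_trans (nr_tri _ (u k) _) _; rewrite lerD ?(ltW ke)//.
apply: le_trans (nr_tri _ (s (u k)) _) _; rewrite lerD//.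
by rewrite nrBC ltW.
Qed.

(* The fixed point found from m + x must be m when x is small, so the midpoint
   of m + x and s (m + x) is within O(|x|^2) of m. *)
Lemma involution_diff (D : set Cn) (s : Cn -> Cn) (m v : Cn) (M c : R) : 0 < c ->
  (forall x, D x -> nr x <= M) -> inverse_pair D D s s ->
  (forall x, nr (x - m) < c + c + c + c -> D x) -> s m = m ->
  (exists2 e : R, 0 < e & forall z, D z -> nr (z - m) < e -> s z = z -> z = m) ->
  'd s m v = - v.
Proof.
move=> c0 DM ip Dm sm [e0 e00 iso]; set K := M / c / c.
have Dmm : D m by apply: Dm; rewrite subrr nr0 !addr_gt0.
have M0 : 0 <= M by apply: le_trans (DM _ Dmm); exact: nr_ge0.
have K0 : 0 <= K by rewrite !divr_ge0 ?(ltW c0).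
have mM y : nr (y - m) < c + c + c + c -> nr (s y) <= M /\ differentiable s y.
  by move=> /Dm /(ip.1 y)[Ds ds _]; split; [exact: DM|].
pose L := M / c + 1; have L0 : 0 < L by rewrite ltr_wpDl// divr_ge0 ?(ltW c0).
(* [L] bounds [nr (s z - z)] by a multiple of [nr x]. The three terms keep the iteration in the
   ball, make it halve the displacement, and put its limit where [m] is the only fixed point. *)
pose q := Num.min (Num.min (c / (2 * L)) (2^-1 / (L * (K + 1)))) (e0 / (2 * L)).
have K1 : 0 < K + 1 by rewrite ltr_wpDl.
have q0 : 0 < q by rewrite !lt_min !divr_gt0 ?mulr_gt0 ?invr_gt0.
have key x : nr x < q -> nr (x + 'd s m x) <= (2 * K * L ^+ 2 + K) * nr x ^+ 2.
  rewrite !lt_min => /andP[/andP[]].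
  rewrite !ltr_pdivlMr ?mulr_gt0// => xc xK xe.
  set z := m + x; have x0 := nr_ge0 x.
  have L1 : 1 <= L by rewrite /L lerDr divr_ge0// ltW.
  have xLx : nr x <= nr x * L by rewrite ler_peMr.
  have xc' : nr x < c by move: xc xLx c0; rewrite mulrCA; clear; lra.
  have sz : nr (s z - z) <= L * nr x.
    have h : nr (s z - s m) <= M / c * nr x.
      apply: lipschitz_estimate => // y ym; apply: mM; apply: lt_trans ym _.
      by move: c0; clear; lra.
    apply: le_trans (nr_tri _ (s m) _) _; rewrite /L mulrDl mul1r lerD//.
    by rewrite sm /z opprD addrA subrr sub0r nrN.
  have zm : nr (z - m) = nr x by rewrite /z addrC addKr.
  set w := nr (s z - z) in sz *; have w0 : 0 <= w by exact: nr_ge0.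
  have zmw : nr (z - m) + w < c.
    rewrite zm; move: sz xc xLx; rewrite mulrCA [L * _]mulrC; clear; lra.
  have Kw : K * w <= 2^-1.
    apply: le_trans (ltW xK); rewrite mulrA mulrC ler_pM ?(ltW K1)//.
    - by rewrite mulrC.
    - by rewrite lerDl.
  pose z1 := z + 2^-1 *: (s z - z).
  have wc : w < c by apply: le_lt_trans zmw; rewrite lerDr nr_ge0.
  have zc : nr (z - m) < c by rewrite zm.
  have w1 := involution_step c0 DM ip Dm zc wc.
  rewrite -/z1 -/w -/K in w1.
  have w1' : nr (s z1 - z1) <= 2^-1 * w.
    by apply: le_trans w1 _; rewrite expr2 mulrA ler_wpM2r.
  have z1z : nr (z1 - z) = 2^-1 * w by rewrite /z1 addrC addKr nrZ nrV nr_nat.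
  have z1m : nr (z1 - m) <= nr (z - m) + 2^-1 * w.
    by apply: le_trans (nr_tri _ z _) _; rewrite z1z addrC.
  have z1c : nr (z1 - m) + nr (s z1 - z1) < c.
    by move: w1' z1m zmw; move: (nr (z - m)) => a; clear; lra.
  have Kw1 : M / c / c * nr (s z1 - z1) <= 2^-1.
    apply: le_trans Kw; rewrite -/K ler_wpM2l//; apply: le_trans w1' _.
    by move: w0; clear; lra.
  have [l sl lz1] := involution_fixpoint c0 DM ip Dm z1c Kw1.
  have lm : nr (l - m) <= nr (z - m) + w.
    apply: le_trans (nr_tri _ z1 _) _.
    by move: lz1 w1' z1m; move: (nr (z - m)) (nr (l - z1)) (nr (z1 - m)) => a b d; clear; lra.
  have lE : l = m.
    apply: iso => //.
      by apply: Dm; apply: le_lt_trans lm _; apply: (lt_trans zmw); move: c0; clear; lra.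
    apply: le_lt_trans lm _; rewrite zm.
    by move: sz xe xLx; rewrite mulrCA [L * _]mulrC; clear; lra.
  rewrite lE nrBC in lz1.
  have h1 : nr (z1 - m) <= K * (L * nr x) ^+ 2.
    apply: le_trans lz1 _; apply: le_trans w1 _; rewrite ler_wpM2l//.
    by rewrite lerXn2r ?nnegrE ?mulr_ge0 ?(ltW L0).
  have h2 : nr (s z - s m - 'd s m x) <= K * nr x ^+ 2.
    apply: taylor_estimate => // y ym; apply: mM; apply: lt_trans ym _.
    by move: c0; clear; lra.
  have -> : x + 'd s m x = 2 *: (z1 - m) - (s z - s m - 'd s m x).
    rewrite sm /z1 /z; move: (s _) ('d s m x) => a d.
    by apply/rowP => j; rewrite !mxE; field.
  apply: le_trans (nrB _ _) _; rewrite nrZ nr_nat.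
  rewrite exprMn in h1; move: h1 h2; move: (nr (z1 - m)) (nr (s z - s m - 'd s m x)) (nr x ^+ 2) (L ^+ 2) => a b d f.
  by clear; nra.
apply/eqP; rewrite eq_sym -subr_eq0 -opprD oppr_eq0 -nr_eq0 eq_le nr_ge0 andbT.
set A := 2 * K * L ^+ 2 + K in key.
have A0 : 0 <= A by rewrite addr_ge0// mulr_ge0 ?sqr_ge0// mulr_ge0.
apply/ler_addgt0Pr => e ep; rewrite add0r.
have v1 : 0 < nr v + 1 by rewrite ltr_wpDl ?nr_ge0.
have B1 : 0 < A * nr v ^+ 2 + 1 by rewrite ltr_wpDl// mulr_ge0// sqr_ge0.
(* The linear map [v + 'd s m v] has a quadratic bound near 0; applied to [t v] and divided by [t],
   this bound tends to 0. *)
pose t := Num.min (q / 2 / (nr v + 1)) (e / (A * nr v ^+ 2 + 1)).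
have t0 : 0 < t by rewrite lt_min !divr_gt0.
have tv : nr (t%:C%C *: v) < q.
  rewrite nrZ nr_real gtr0_norm//.
  apply: le_lt_trans (_ : q / 2 < q); last by move: q0; clear; lra.
  apply: le_trans (_ : q / 2 / (nr v + 1) * (nr v + 1) <= _); last by rewrite mulfVK ?gt_eqF.
  by rewrite ler_pM ?nr_ge0 ?(ltW t0)// ?ge_min ?lexx// lerDl.
have := key _ tv; rewrite linearZ/= -scalerDr !nrZ nr_real gtr0_norm//.
rewrite exprMn [A * _]mulrCA expr2 -[t * t * _]mulrA ler_pM2l// => H.
apply: le_trans H _; apply: le_trans (_ : t * (A * nr v ^+ 2 + 1) <= _).
  by rewrite ler_wpM2l ?(ltW t0)// lerDl.
apply: le_trans (_ : e / (A * nr v ^+ 2 + 1) * (A * nr v ^+ 2 + 1) <= _).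
  by rewrite ler_pM2r// ge_min lexx orbT.
by rewrite mulfVK ?gt_eqF.
Qed.

(** The points [j v] of the segment from 0 to [x] are treated in turn. An automorphism that takes
    [j v] within [e1 / 2] of 0 takes the next point within [e1], by a Lipschitz estimate uniform
    over all automorphisms, and one further symmetry halves its norm. Repeated halving at the end
    brings the image of [x] as near to 0 as desired. *)
Lemma homogeneous (D : set Cn) (M e0 : R) : convexr D -> open D -> 0 < e0 ->
  (forall x, nr x < e0 -> D x) -> (forall x, D x -> nr x <= M) ->
  (forall m, D m -> exists s, [/\ inverse_pair D D s s, s m = m &
    exists2 e : R, 0 < e & forall z, D z -> nr (z - m) < e -> s z = z -> z = m]) ->
  forall x, D x -> forall e, 0 < e ->
  exists f g, inverse_pair D D f g /\ nr (f x) < e.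
Proof.
move=> cD oD e00 De DM symD.
have M0 : 0 <= M by apply: le_trans (DM 0 _); rewrite ?nr_ge0//; apply: De; rewrite nr0.
(* The midpoint [m] has norm below [c] and needs a ball of radius [4 c] in [D]. *)
have [c c0 e0E] : exists2 c, 0 < c & e0 = 5 * c.
  by exists (e0 / 5); [rewrite divr_gt0|field].
pose K := M / c / c; have K0 : 0 <= K by rewrite !divr_ge0 ?(ltW c0).
have near x : nr x < c -> exists2 s, inverse_pair D D s s & nr (s x) <= K * nr x ^+ 2.
  move=> xc; pose m := 2^-1 *: x.
  have nm : nr m = 2^-1 * nr x by rewrite nrZ nrV nr_nat.
  have x0 := nr_ge0 x.
  have mc : nr m < c by rewrite nm; move: xc x0 c0; clear; lra.
  have Dm y : nr (y - m) < c + c + c + c -> D y.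
    move=> ym; apply: De; rewrite e0E -[y](subrK m); apply: le_lt_trans (nrD _ _) _.
    by move: ym mc; move: (nr _) (nr _) => a b; clear; lra.
  have Dmm : D m by apply: Dm; rewrite subrr nr0 !addr_gt0.
  have [s [ip sm iso]] := symD m Dmm; exists s => //.
  have ds := involution_diff m c0 DM ip Dm sm iso.
  have mM y : nr (y - m) < c + c + c -> nr (s y) <= M /\ differentiable s y.
    move=> ym; have /(ip.1 y)[Ds dsy _] : D y.
      by apply: Dm; apply: lt_trans ym _; move: c0; clear; lra.
    by split; [exact: DM|].
  have := taylor_estimate c0 mM mc; rewrite ds sm opprK.
  have -> : m + m = x by apply/rowP => j; rewrite !mxE; field.
  rewrite subrK => H; apply: le_trans H _; rewrite ler_wpM2l// nm exprMn.
  by rewrite ler_piMl ?sqr_ge0// exprn_ile1//; clear; lra.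
have [e1 e10 [e1c Ke1]] : exists2 e1, 0 < e1 & e1 < c /\ K * e1 <= 2^-1.
  have K1 : 0 < K + 1 by rewrite ltr_wpDl.
  exists (Num.min (c / 2) (2^-1 / (K + 1))); first by rewrite lt_min !divr_gt0.
  split; first by rewrite gt_min; apply/orP; left; move: c0; clear; lra.
  apply: le_trans (_ : (K + 1) * (2^-1 / (K + 1)) <= _).
    by rewrite ler_pM ?le_min ?ge_min ?lexx ?orbT ?lerDl// !divr_ge0 ?(ltW c0) ?(ltW K1).
  by rewrite mulrC mulfVK ?gt_eqF.
have half x : nr x <= e1 -> exists2 s, inverse_pair D D s s & nr (s x) <= 2^-1 * nr x.
  move=> xe; have [|s ip sx] := near x; first exact: le_lt_trans e1c.
  exists s => //; apply: le_trans sx _; rewrite expr2 mulrA ler_wpM2r ?nr_ge0//.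
  by apply: le_trans Ke1; rewrite ler_wpM2l.
have small x k : nr x <= e1 -> exists f g, inverse_pair D D f g /\ nr (f x) <= 2^-1 ^+ k * e1.
  move=> xe; elim: k => [|k [f [g [ip fx]]]].
    by exists id, id; split; [exact: inverse_pair_id|rewrite expr0 mul1r].
  have [|s ips sx] := half (f x).
    apply: le_trans fx _; rewrite ler_piMl ?(ltW e10)//.
    by apply: exprn_ile1; clear; lra.
  exists (s \o f), (g \o s); split; first exact: inverse_pair_comp ip ips.
  apply: le_trans sx _; rewrite exprS -mulrA ler_pM2l//.
move=> x Dx e ep.
suff [f [g [ip fx]]] : exists f g, inverse_pair D D f g /\ nr (f x) <= e1.
  have [k /(_ k (leqnn k)) ke] := half_pow_lt (divr_gt0 ep e10).
  have [f' [g' [ip' fx']]] := small (f x) k fx.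
  exists (f' \o f), (g \o g'); split; first exact: inverse_pair_comp ip ip'.
  by apply: le_lt_trans fx' _; rewrite -ltr_pdivlMr.
have [r /andP[/ltW r0 r1] [x' Dx' xE]] := open_scale oD Dx.
have r01 : 0 <= r < 1 by rewrite r0.
have t0 : 0 < (1 - r) * e0 by rewrite mulr_gt0// subr_gt0.
have [t tp tE] : exists2 t, 0 < t & (1 - r) * e0 = t + t.
  by exists ((1 - r) * e0 / 2); [rewrite divr_gt0|field].
pose L := M / t + 1; have L0 : 0 < L by rewrite ltr_wpDl// divr_ge0// ltW.
pose k := Num.min t (e1 / 2 / L); have k0 : 0 < k by rewrite lt_min tp !divr_gt0.
pose N := (Num.truncn (nr x / k)).+1.
have NM : nr x < k * N%:R by rewrite [k * _]mulrC -ltr_pdivrMr// truncnS_gt.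
have N0 : 0 < N%:R :> R by rewrite ltr0n.
pose v := N%:R^-1 *: x.
have vk : nr v < k by rewrite nrZ nrV nr_nat mulrC ltr_pdivrMr.
have tube j y : (j <= N)%N -> nr (y - j%:R *: v) < t + t -> D y.
  move=> jN; have jN1 : 0 <= (j%:R / N%:R : R) <= 1.
    by rewrite divr_ge0//= ler_pdivrMr// mul1r ler_nat.
  have D0 : D 0 by apply: De; rewrite nr0.
  have := cD _ _ _ jN1 D0 Dx'; rewrite scaler0 add0r => Dj.
  rewrite -tE => yj; apply: (convexr_scale_tube cD De r01 Dj).
  rewrite scalerA mulrC -scalerA -xE rmorphM fmorphV/= !rmorph_nat.
  by rewrite -scalerA.
have vN : N%:R *: v = x.
  by rewrite /v scalerA mulfV ?scale1r// pnatr_eq0.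
suff H j : (j <= N)%N -> exists f g, inverse_pair D D f g /\ nr (f (j%:R *: v)) <= e1 / 2.
  have [f [g [ip]]] := H N (leqnn N); rewrite vN => fx.
  by exists f, g; split => //; apply: le_trans fx _; move: e10; clear; lra.
elim: j => [_|j IH jN].
  exists id, id; split; first exact: inverse_pair_id.
  by rewrite scale0r nr0 divr_ge0// ltW.
have [f [g [ip fj]]] := IH (ltnW jN).
have fj1 : nr (f (j.+1%:R *: v)) <= e1.
  rewrite -natr1 scalerDl scale1r -[X in nr X](subrK (f (j%:R *: v))).
  apply: le_trans (nrD _ _) _; rewrite [e1]splitr lerD//.
  apply: le_trans (_ : M / t * nr v <= _).
    apply: lipschitz_estimate => //; last by apply: lt_le_trans vk _; rewrite ge_min lexx.
    move=> y yj; have [Df df _] := ip.1 y (tube j y (ltnW jN) yj).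
    by split; [exact: DM|].
  apply: le_trans (_ : L * k <= _).
    by rewrite ler_pM ?nr_ge0 ?divr_ge0 ?(ltW tp) ?(ltW vk)// lerDl.
  by rewrite mulrC -ler_pdivlMr// ge_min lexx orbT.
have [f' [g' [ip' fx']]] := small _ 1%N fj1.
exists (f' \o f), (g \o g'); split; first exact: inverse_pair_comp ip ip'.
by apply: le_trans fx' _; rewrite expr1 mulrC.
Qed.

End Homogeneity.

(** * The linear isomorphism *)

Section LocalInverse.
Variable R : realType.
Local Notation C := R[i].
Variable n : nat.
Local Notation Cn := 'rV[C]_n.
Implicit Types (D E U V : set Cn) (f g F : Cn -> Cn).

(** Start from a point [F x] with [x] in [D1] near [p] and follow the segment from [F x] to [y],
    which stays in [D2] and in [V]. Its image under [g] starts in [D1] and never meets the boundary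
    of [D1], because the open set [D2] does not meet its own boundary. *)
Lemma preimage_near D1 D2 U V F g p : open D1 -> open D2 -> convexr D2 -> open U -> open V ->
  inverse_pair U V F g -> closure D1 p -> U p ->
  F @` (U `&` D1) `<=` D2 -> F @` (U `&` boundary D1) `<=` boundary D2 ->
  exists2 d : R, 0 < d & forall y, D2 y -> nr (y - F p) < d -> V y /\ D1 (g y).
Proof.
move=> oD1 oD2 cD2 oU oV [FP gP] clp Up FD Fbd.
have [VFp dFp _] := FP p Up.
have [d d0 dV] := (open_nr V).1 oV _ VFp.
have [d1 d10 dU] := (open_nr U).1 oU _ Up.
have [d2 d20 dF] := differentiable_nr dFp d0.
have [x Dx] := (closure_nr D1 p).1 clp (Num.min d1 d2) ltac:(by rewrite lt_min d10).
rewrite lt_min => /andP[/dU Ux /dF xF].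
have [VFx _ gFx] := FP _ Ux.
have D2Fx : D2 (F x) by apply: FD; exists x.
exists d => // y Dy yF.
pose z (t : R) : Cn := (1 - t)%:C%C *: F x + t%:C%C *: y.
have Vz t : 0 <= t <= 1 -> V (z t).
  move=> t01; case/andP: (t01) => t0 t1; apply: dV.
  have -> : z t - F p = (1 - t)%:C%C *: (F x - F p) + t%:C%C *: (y - F p).
    by rewrite /z rmorphB; apply/rowP => j; rewrite !mxE; ring.
  apply: le_lt_trans (nrD _ _) _; rewrite !nrZ !nr_real !ger0_norm ?subr_ge0//.
  have [t10|t10] := eqVneq t 1; first by rewrite t10 subrr mul0r add0r mul1r.
  have tlt1 : t < 1 by rewrite lt_neqAle t10.
  have -> : d = (1 - t) * d + t * d by ring.
  by apply: ltr_leD; [rewrite ltr_pM2l// subr_gt0|rewrite ler_wpM2l// ltW].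
have D2z t : 0 <= t <= 1 -> D2 (z t) by move=> t01; exact: cD2.
have lipz s t : nr (z s - z t) = `|s - t| * nr (y - F x).
  rewrite -nr_real -nrZ; congr nr; rewrite /z !rmorphB.
  by apply/rowP => j; rewrite !mxE; ring.
have gc c (e : R) : 0 <= c <= 1 -> 0 < e -> exists2 r, 0 < r &
    forall t, 0 <= t <= 1 -> `|t - c| < r -> nr (g (z t) - g (z c)) < e.
  move=> c01 e0; have [_ dg _] := gP _ (Vz c c01).
  have [r r0 rP] := differentiable_nr dg e0.
  have w1 : 0 < nr (y - F x) + 1 by rewrite ltr_wpDl ?nr_ge0.
  exists (r / (nr (y - F x) + 1)) => [|t t01]; first by rewrite divr_gt0.
  rewrite ltr_pdivlMr// => tc; apply: rP; rewrite lipz.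
  by apply: le_lt_trans tc; rewrite ler_wpM2l// lerDl.
(* As an implication between end points the claim composes under bisection. Near [c] it holds
   because [g (z c)] is either in [D1] or outside its closure, where the premise fails. *)
have : D1 (g (z 0)) -> D1 (g (z 1)).
  apply: (@bisection R (fun a b => D1 (g (z a)) -> D1 (g (z b))) 0 1).
  - exact: ler01.
  - by move=> a b _ _ _ h1 h2 /h1.
  move=> c c01; have [Ug _ Fg] := gP _ (Vz c c01).
  have [D1c|nD1c] := pselect (D1 (g (z c))).
    have [e e0 eP] := (open_nr D1).1 oD1 _ D1c.
    have [r r0 rP] := gc c e c01 e0.
    exists r; first exact: r0.
    move=> a b /andP[a0 ac] /andP[cb b1] ba _; apply: eP; apply: rP.
      by move: a0 ac cb b1; clear; lra.
    by rewrite ltr_norml; move: ac cb ba r0; clear; lra.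
  have ncl : ~ closure D1 (g (z c)).
    move=> cl; have bd : boundary D1 (g (z c)).
      by split => // /interior_subset.
    have [_] : boundary D2 (z c) by rewrite -Fg; apply: Fbd; exists (g (z c)).
    by apply; have := D2z c c01; move: (oD2); rewrite openE; apply.
  have [e e0 eP] : exists2 e : R, 0 < e & forall w, D1 w -> e <= nr (w - g (z c)).
    apply: contrapT => no; apply: ncl; apply/closure_nr => e e0.
    apply: contrapT => no2; apply: no; exists e => // w Dw.
    by rewrite leNgt; apply/negP => we; apply: no2; exists w.
  have [r r0 rP] := gc c e c01 e0.
  exists r; first exact: r0.
  move=> a b /andP[a0 ac] /andP[cb b1] ba Da; exfalso.
  have := eP _ Da; rewrite leNgt => /negP; apply; apply: rP.
    by move: a0 ac cb b1; clear; lra.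
  by rewrite ltr_norml; move: ac cb ba; clear; lra.
have z0 : z 0 = F x by rewrite /z subr0 scale1r scale0r addr0.
have z1 : z 1 = y by rewrite /z subrr scale1r scale0r add0r.
rewrite z0 z1 gFx => H; split; last exact: H.
by rewrite -z1; apply: Vz; rewrite ler01 lexx.
Qed.

Lemma diff_id_near (f : Cn -> Cn) (e : R) v : 0 < e -> differentiable f 0 ->
  (forall x, nr x < e -> f x = x) -> 'd f 0 v = v.
Proof.
move=> e0 df fx; apply/eqP; rewrite eq_sym -subr_eq0 -nr_eq0 eq_le nr_ge0 andbT.
apply/ler_addgt0Pr => u u0; rewrite add0r.
have v1 : 0 < nr v + 1 by rewrite ltr_wpDl ?nr_ge0.
have [r r0 rP] := diff_nr df (divr_gt0 u0 v1).
pose t := Num.min (e / 2) (r / 2) / (nr v + 1).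
have m0 : 0 < Num.min (e / 2) (r / 2) by rewrite lt_min !divr_gt0.
have t0 : 0 < t by rewrite divr_gt0.
have tv : nr (t%:C%C *: v) < Num.min e r.
  rewrite nrZ nr_real gtr0_norm// /t.
  apply: le_lt_trans (_ : Num.min (e / 2) (r / 2) < _).
    by rewrite mulrAC ler_pdivrMr// ler_pM2l// lerDl.
  rewrite lt_min !gt_min; apply/andP; split; apply/orP; [left|right].
    by move: e0; clear; lra.
  by move: r0; clear; lra.
move: tv; rewrite lt_min => /andP[/fx tve /rP].
rewrite add0r tve (fx 0) ?nr0// subr0 linearZ/= -scalerBr !nrZ nr_real gtr0_norm//.
rewrite mulrCA ler_pM2l// => H; apply: le_trans H _.
by rewrite mulrAC ler_pdivrMr// ler_pM2l// lerDl.
Qed.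

End LocalInverse.

(** * Linear maps that preserve the domains up to a factor r *)

Section Approximation.
Variable R : realType.
Local Notation C := R[i].
Variable n : nat.
Local Notation Cn := 'rV[C]_n.
Implicit Types (D E U V : set Cn) (f g F : Cn -> Cn).

(** The inclusions lose the factor [r], but [A *m B] is exactly the identity; [linear_limit] relies
    on this equation. *)
Lemma linear_approximation D1 D2 U V F G p a (e1 e2 M1 M2 r : R) :
  open D1 -> convexr D1 -> balanced D1 -> 0 < e1 -> (forall x, nr x < e1 -> D1 x) ->
  (forall x, D1 x -> nr x <= M1) ->
  open D2 -> convexr D2 -> balanced D2 -> 0 < e2 -> (forall x, nr x < e2 -> D2 x) ->
  (forall x, D2 x -> nr x <= M2) ->
  local_peak D1 p -> local_peak D2 (F p) ->
  open U -> U p -> inverse_pair U V F G ->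
  F @` (U `&` D1) `<=` D2 ->
  (exists2 d, 0 < d & forall y, D2 y -> nr (y - F p) < d -> V y /\ D1 (G y)) ->
  (forall x, D2 x -> forall e, 0 < e -> exists f g, inverse_pair D2 D2 f g /\ nr (f x) < e) ->
  D1 a ->
  (forall e, 0 < e -> exists f g, inverse_pair D1 D1 f g /\ nr (f a - p) < e) ->
  0 < r < 1 ->
  exists A B : 'M[C]_n, [/\ A *m B = 1%:M,
    forall v, D1 v -> closure D2 (r%:C%C *: (v *m A)) &
    forall w, D2 w -> closure D1 (r%:C%C *: (w *m B))].
Proof.
move=> oD1 cD1 bD1 e10 De1 DM1 oD2 cD2 bD2 e20 De2 DM2 pk1 pk2 oU Up [FP GP] FD
  [d2 d20 d2P] hom2 D1a acc /andP[r0 r1].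
have [ra ra01 [a' D1a' aE]] := open_scale oD1 D1a.
(* [rho1] and [rho] divide the interval from [r] to 1 into thirds. The maps are defined on [rho D1]
   and [rho D2]; [rho1] leaves room for discs whose centre is not exactly 0. *)
pose rho1 := (2 * r + 1) / 3; pose rho := (r + 2) / 3.
have rr1 : r < rho1 by rewrite /rho1; move: r1; clear; lra.
have rho1rho : rho1 < rho by rewrite /rho1 /rho; move: r1; clear; lra.
have rho_1 : rho < 1 by rewrite /rho; move: r1; clear; lra.
have rho0 : 0 < rho by rewrite /rho; move: r0; clear; lra.
(* [r' D1] contains both [a], where the automorphism is known to be near [p], and all of
   [rho D1]. *)
pose r' := Num.max rho ra.
have r'01 : 0 <= r' < 1.
  by case/andP: ra01 => _ ra1; rewrite le_max (ltW rho0)/= gt_max rho_1 ra1.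
have r'0 : 0 < r' by rewrite lt_max rho0.
have D10 : D1 0 by apply: De1; rewrite nr0.
have D20 : D2 0 by apply: De2; rewrite nr0.
have [d1 d10 dU] := (open_nr U).1 oU _ Up.
have rho01 : 0 <= rho < 1 by rewrite (ltW rho0).
(* The constants are chosen backwards: from the neighbourhood of [F p] in which points of [D2] have
   preimages in [D1], to a neighbourhood of [p], and only then the automorphism [f]. *)
have [d2' d2'0 at2] := attraction pk2 DM2 cD2 e20 De2 DM2 rho01 d20.
have [VFp dFp _] := FP p Up.
have [eta eta0 Feta] := differentiable_nr dFp d2'0.
have [d1' d1'0 at1] := attraction pk1 DM1 cD1 e10 De1 DM1 r'01
  (ltac:(by rewrite lt_min d10) : 0 < Num.min d1 eta).
have [f [g [[fP gP] fa]]] := acc d1' d1'0.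
have fnear x : D1 x -> U (f (rho%:C%C *: x)) /\ nr (f (rho%:C%C *: x) - p) < eta.
  move=> Dx.
  have [a2 D1a2 a2E] := balanced_scale bD1 (s := ra) (t := r') (x := a')
    ltac:(by case/andP: ra01 => /ltW -> _; rewrite le_max lexx orbT) r'0 D1a'.
  have [x2 D1x2 x2E] := balanced_scale bD1 (s := rho) (t := r') (x := x)
    ltac:(by rewrite (ltW rho0) le_max lexx) r'0 Dx.
  have := at1 f (fun x Dx => let: And3 u v _ := fP x Dx in conj u v) a2 x2 D1a2 D1x2.
  by rewrite -a2E -aE -x2E lt_min => /(_ fa) /andP[/dU].
have D1rho x : D1 x -> D1 (rho%:C%C *: x).
  by move=> Dx; apply: bD1 => //; rewrite nrE lecR nr_real ger0_norm ?ltW.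
have D2rho x : D2 x -> D2 (rho%:C%C *: x).
  by move=> Dx; apply: bD2 => //; rewrite nrE lecR nr_real ger0_norm ?ltW.
have Ffx x : D1 x -> [/\ D2 (F (f (rho%:C%C *: x))), differentiable F (f (rho%:C%C *: x)) &
    G (F (f (rho%:C%C *: x))) = f (rho%:C%C *: x)].
  move=> Dx; have [Uf _] := fnear x Dx; have [D1f _ _] := fP _ (D1rho x Dx).
  have [_ dF GF] := FP _ Uf; split; [|exact: dF|exact: GF].
  by apply: FD; exists (f (rho%:C%C *: x)).
have [x0D2 _ _] := Ffx 0 D10.
have [_ x0n] := fnear 0 D10.
set x0 := F (f (rho%:C%C *: 0)) in x0D2.
have x0p : nr (x0 - F p) < d2' by apply: Feta.
(* The first bound puts [y0] in [rho D2]; the second puts the discs around [y0] of radius [rho1] in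
   directions of [D2] there as well. *)
pose s := Num.min (rho * e2) ((rho - rho1) * e2).
have s0 : 0 < s.
  by rewrite lt_min (mulr_gt0 rho0 e20)/=; apply: mulr_gt0 => //; rewrite subr_gt0.
have [psi [psi' [[psiP psi'P] psix0]]] := hom2 x0 x0D2 s s0.
set y0 := psi x0 in psix0.
move: psix0; rewrite lt_min => /andP[y01 y02].
have [D2y0 _ psi'y0] := psiP _ x0D2; rewrite -/y0 in D2y0 psi'y0.
(* [psi'] takes the one point [y0] of [rho D2] to [x0], which is near [F p]; attraction extends this
   to all of [rho D2]. *)
have psi'near y : D2 y -> nr (psi' (rho%:C%C *: y) - F p) < d2.
  move=> Dy; apply: (at2 psi' (fun x Dx => let: And3 u v _ := psi'P x Dx in conj u v)
    ((rho^-1)%:C%C *: y0)) => //.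
    apply: De2; rewrite nrZ nr_real ger0_norm ?invr_ge0 ?(ltW rho0)//.
    by rewrite mulrC ltr_pdivrMr// mulrC.
  by rewrite scalerA -rmorphM mulfV ?gt_eqF// scale1r psi'y0.
(* [GG] and [HH] are the maps G and H of the overview, whereas [G] is the local inverse of [F]. *)
pose GG := psi \o (F \o f).
pose HH := g \o (G \o psi').
have GGP x : D1 x -> D2 (GG (rho%:C%C *: x)) /\ differentiable GG (rho%:C%C *: x).
  move=> Dx; have [D2F dF _] := Ffx x Dx; have [_ df _] := fP _ (D1rho x Dx).
  have [D2p dpsi _] := psiP _ D2F; split; first exact: D2p.
  exact: (differentiable_comp (differentiable_comp df dF) dpsi).
have HHP y : D2 y -> D1 (HH (rho%:C%C *: y)) /\ differentiable HH (rho%:C%C *: y).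
  move=> Dy; have [D2p dpsi _] := psi'P _ (D2rho y Dy).
  have [Vp D1G] := d2P _ D2p (psi'near y Dy).
  have [_ dG _] := GP _ Vp; have [D1g dg _] := gP _ D1G.
  split; first exact: D1g.
  exact: (differentiable_comp (differentiable_comp dpsi dG) dg).
have HG x : D1 x -> HH (GG (rho%:C%C *: x)) = rho%:C%C *: x.
  move=> Dx; have [D2F _ GF] := Ffx x Dx; have [_ _ pp] := psiP _ D2F.
  have [_ _ gf] := fP _ (D1rho x Dx).
  exact: etrans (f_equal (fun u => g (G u)) pp) (etrans (f_equal g GF) gf).
have GG0 : GG 0 = y0 by rewrite /y0 /x0 scaler0.
have rhoK (x : Cn) : rho%:C%C *: ((rho^-1)%:C%C *: x) = x.
  by rewrite scalerA -rmorphM mulfV ?gt_eqF// scale1r.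
have [_ dGG] := GGP 0 D10; rewrite scaler0 in dGG.
have dHH (y : Cn) : nr (y - y0) < rho * e2 - nr y0 -> differentiable HH y.
  move=> yy0; have Dy : D2 ((rho^-1)%:C%C *: y).
    apply: De2; rewrite nrZ nr_real ger0_norm ?invr_ge0 ?(ltW rho0)//.
    rewrite mulrC ltr_pdivrMr// mulrC -[y](subrK y0).
    by apply: le_lt_trans (nrD _ _) _; rewrite -ltrBrDr.
  have [_ dy] := HHP _ Dy; rewrite rhoK in dy; exact: dy.
have dHHy0 : differentiable HH y0 by apply: dHH; rewrite subrr nr0 subr_gt0.
have dHH0 : differentiable HH (GG 0) by rewrite GG0.
have BA v : 'd HH y0 ('d GG 0 v) = v.
  have dc := diff_comp dGG dHH0.
  have h : 'd (HH \o GG) 0 v = v.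
    apply: (diff_id_near (e := rho * e1)).
    - by rewrite mulr_gt0.
    - exact: (differentiable_comp dGG dHH0).
    - move=> x xe; have Dx : D1 ((rho^-1)%:C%C *: x).
        apply: De1; rewrite nrZ nr_real ger0_norm ?invr_ge0 ?(ltW rho0)//.
        by rewrite mulrC ltr_pdivrMr// mulrC.
      have HGx := HG _ Dx; rewrite rhoK in HGx; exact: HGx.
  rewrite -[RHS]h -GG0.
  exact: esym (f_equal (fun k : Cn -> Cn => k v) dc).
exists (lin1_mx ('d GG 0)), (lin1_mx ('d HH y0)); split.
- apply/row_matrixP => i; rewrite row_mul rowE mul_rV_lin1 mul_rV_lin1.
  by rewrite BA rowE mulmx1.
- move=> v Dv; rewrite mul_rV_lin1.
  apply: (schwarz_slice (rho := rho) cD2 bD2); last by rewrite r0 (lt_trans rr1).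
  move=> t tr; rewrite add0r.
  have [v2 D1v2 v2E] : exists2 v2, D1 v2 & t *: v = rho%:C%C *: v2.
    exists (((rho^-1)%:C%C * t) *: v); last first.
      by rewrite scalerA mulrA -rmorphM mulfV ?gt_eqF// mul1r.
    apply: bD1 => //; rewrite nrE lecR nrM nr_real ger0_norm ?invr_ge0 ?(ltW rho0)//.
    by rewrite mulrC ler_pdivrMr// mul1r ltW.
  by rewrite v2E; exact: GGP.
- move=> w Dw; rewrite mul_rV_lin1.
  apply: (schwarz_slice (rho := rho1) cD1 bD1); last by rewrite r0 rr1.
  move=> t tr.
  (* Divided by [rho], this point is the combination of [y0 / (rho - rho1)] and [t w / rho1], both
     in [D2], with weights [1 - rho1 / rho] and [rho1 / rho]. *)
  have [v2 D1v2 v2E] : exists2 v2, D2 v2 & y0 + t *: w = rho%:C%C *: v2.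
    have rho10 : 0 < rho1 by apply: lt_trans rr1.
    have D2w : D2 (((rho1^-1)%:C%C * t) *: w).
      apply: bD2 => //; rewrite nrE lecR nrM nr_real ger0_norm ?invr_ge0 ?(ltW rho10)//.
      by rewrite mulrC ler_pdivrMr// mul1r ltW.
    have D2y : D2 (((rho - rho1)^-1)%:C%C *: y0).
      apply: De2; rewrite nrZ nr_real ger0_norm ?invr_ge0 ?subr_ge0 ?(ltW rho1rho)//.
      by rewrite mulrC ltr_pdivrMr ?subr_gt0// mulrC.
    have l01 : 0 <= rho1 / rho <= 1.
      by rewrite divr_ge0 ?(ltW rho10) ?(ltW rho0)//= ler_pdivrMr// mul1r ltW.
    have D2c := cD2 _ _ _ l01 D2y D2w; exists (((1 - rho1 / rho))%:C%C *: (((rho - rho1)^-1)%:C%C *: y0) + (rho1 / rho)%:C%C *: (((rho1^-1)%:C%C * t) *: w)) => //.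
    rewrite scalerDr !scalerA mulrA -!rmorphM.
    have -> : rho * (1 - rho1 / rho) / (rho - rho1) = 1.
      have drho : 0 < rho - rho1 by rewrite subr_gt0.
      by field; rewrite (gt_eqF rho0) (gt_eqF drho).
    have -> : rho * (rho1 / rho) / rho1 = 1.
      by field; rewrite (gt_eqF rho0) (gt_eqF rho10).
    by rewrite mul1r !scale1r.
  by rewrite v2E; exact: HHP.
Qed.

End Approximation.

(** * The limit as r tends to 1 *)

Section Limit.
Variable R : realType.
Local Notation C := R[i].

Lemma nr_sum (V : normedModType C) (I : Type) (s : seq I) (x : I -> V) :
  nr (\sum_(i <- s) x i) <= \sum_(i <- s) nr (x i).
Proof.
elim: s => [|i s IH]; first by rewrite !big_nil nr0.
by rewrite !big_cons; apply: le_trans (nrD _ _) _; rewrite lerD2l.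
Qed.

Lemma nr_mulmx m n k (v : 'M[C]_(m, n)) (X : 'M[C]_(n, k)) :
  nr (v *m X) <= n%:R * nr v * nr X.
Proof.
apply: nr_matrix_le => [|i j]; first by rewrite !mulr_ge0 ?nr_ge0.
rewrite mxE; apply: le_trans (nr_sum _ _) _.
apply: le_trans (_ : \sum_(l < n) nr v * nr X <= _).
  by apply: ler_sum => l _; rewrite nrM ler_pM ?nr_ge0 ?nr_entry.
by rewrite sumr_const card_ord -mulrA mulr_natl.
Qed.

Variable n : nat.
Local Notation Cn := 'rV[C]_n.
Implicit Types D E : set Cn.

Lemma differentiable_mulmxr (A : 'M[C]_n) (x : Cn) : differentiable (mulmxr A : Cn -> Cn) x.
Proof.
suff cA (y : Cn) : (mulmxr A : Cn -> Cn) @ y --> (mulmxr A y : Cn).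
  exact: linear_differentiable.
move=> P /near_nr[e e0 eP].
have A1 : 0 < n%:R * nr A + 1 by rewrite ltr_wpDl// mulr_ge0 ?nr_ge0.
suff : \forall z \near y, P (z *m A) by [].
apply/near_nr; exists (e / (n%:R * nr A + 1)); first by rewrite divr_gt0.
move=> z; rewrite ltr_pdivlMr// => zy; apply: eP.
rewrite /= -mulmxBl; apply: le_lt_trans (nr_mulmx _ _) _.
apply: le_lt_trans zy; rewrite mulrAC mulrC.
by rewrite ler_wpM2l ?nr_ge0// lerDl.
Qed.

Lemma closure_bounded D (M : R) x : (forall x, D x -> nr x <= M) -> closure D x -> nr x <= M.
Proof.
move=> DM /closure_nr cl; apply/ler_addgt0Pr => e e0; have [y Dy yx] := cl e e0.
rewrite -[x](subrK y) addrC; apply: le_trans (nrD _ _) _.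
by rewrite lerD ?DM// nrBC ltW.
Qed.

(** Row [i] of [A] is tested on the vector [e / 2] times the basis vector [i], which lies in [D].
    With [r] at least 1/2 the bound does not depend on [r]. *)
Lemma matrix_bound D E (A : 'M[C]_n) (e M r : R) : 0 < e -> (forall x, nr x < e -> D x) ->
  (forall x, E x -> nr x <= M) -> 2^-1 <= r ->
  (forall v, D v -> closure E (r%:C%C *: (v *m A))) -> nr A <= 4 * M / e.
Proof.
move=> e0 De EM r2 DA; have r0 : 0 < r by apply: lt_le_trans r2; rewrite invr_gt0.
have D0 : D 0 by apply: De; rewrite nr0.
have M0 : 0 <= M.
  by have := closure_bounded EM (DA _ D0); apply: le_trans; exact: nr_ge0.
apply: nr_matrix_le => [|i j]; first by rewrite divr_ge0 ?mulr_ge0 ?(ltW e0).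
have Dd : D ((e / 2)%:C%C *: delta_mx 0 i).
  apply: De; rewrite nrZ nr_real ger0_norm ?divr_ge0 ?(ltW e0)//.
  apply: le_lt_trans (_ : e / 2 * 1 < e); last by move: e0; clear; lra.
  rewrite ler_pM2l ?divr_gt0//; apply: nr_matrix_le => // k l.
  by rewrite mxE; case: (_ && _); rewrite ?nr1 ?nr0.
have := closure_bounded EM (DA _ Dd).
rewrite -scalemxAl -rowE !nrZ !nr_real !gtr0_norm ?divr_gt0// => H.
rewrite ler_pdivlMr//; have a0 := nr_ge0 (row i A).
have h : nr (A i j) <= nr (row i A).
  by have := nr_entry (row i A) 0 j; rewrite mxE.
have h2 : e * nr (row i A) <= 4 * M.
  move: H; have : 0 <= e * nr (row i A) by rewrite mulr_ge0// ltW.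
  have -> : r * (e / 2 * nr (row i A)) = r * (e * nr (row i A)) / 2 by field.
  by move: (e * nr (row i A)) r2 M0 => x; clear; nra.
by apply: le_trans h2; rewrite mulrC ler_pM2l.
Qed.

(** Only the matrices [A k] are made to converge. From [v = v A B] and the uniform bound on the
    [B k] follows a lower bound for [v *m L], so [L] is invertible. In the limit [L] maps [D1] into
    the closure of [D2], and its inverse maps [D2] into the closure of [D1]; the closures disappear
    because each point of an open domain is [s < 1] times another of its points. *)
Lemma linear_limit D1 D2 (e1 e2 M1 M2 : R) :
  open D1 -> convexr D1 -> 0 < e1 -> (forall x, nr x < e1 -> D1 x) ->
  (forall x, D1 x -> nr x <= M1) ->
  open D2 -> convexr D2 -> 0 < e2 -> (forall x, nr x < e2 -> D2 x) ->
  (forall x, D2 x -> nr x <= M2) ->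
  (forall r : R, 0 < r < 1 -> exists A B : 'M[C]_n, [/\ A *m B = 1%:M,
    forall v, D1 v -> closure D2 (r%:C%C *: (v *m A)) &
    forall w, D2 w -> closure D1 (r%:C%C *: (w *m B))]) ->
  exists L : 'M[C]_n, biholomorphic D1 D2 (mulmxr L : Cn -> Cn).
Proof.
move=> oD1 cD1 e10 De1 DM1 oD2 cD2 e20 De2 DM2 app.
(* The shift by 2 makes [r k] at least 1/2, as [matrix_bound] requires. *)
pose r (k : nat) : R := 1 - (k.+2%:R)^-1.
have k2 k : (k.+2%:R^-1 : R) <= 2^-1 by rewrite lef_pV2 ?posrE// ler_nat.
have k20 k : 0 < (k.+2%:R^-1 : R) by rewrite invr_gt0.
have r2 k : 2^-1 <= r k by have := k2 k; rewrite /r; move: (k.+2%:R^-1) => x; clear; lra.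
have r01 k : 0 < r k < 1 by have := k2 k; have := k20 k; rewrite /r; move: (k.+2%:R^-1) => x; clear; lra.
have /choice[A /choice[B AB]] := fun k => app (r k) (r01 k).
have A1 k : nr (A k) <= 4 * M2 / e1.
  by have [_ h _] := AB k; exact: matrix_bound De1 DM2 (r2 k) h.
have B1 k : nr (B k) <= 4 * M1 / e2.
  by have [_ _ h] := AB k; exact: matrix_bound De2 DM1 (r2 k) h.
set a1 := 4 * M2 / e1 in A1; set b1 := 4 * M1 / e2 in B1.
have a10 : 0 <= a1 by apply: le_trans (A1 0%N); exact: nr_ge0.
have b10 : 0 <= b1 by apply: le_trans (B1 0%N); exact: nr_ge0.
have [L LP] := bolzano_weierstrass_mx A1.
have LPv (v : Cn) (e : R) : 0 < e -> exists2 k, nr (v *m A k - v *m L) < e & (1 - r k) < e.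
  move=> e0; pose w := n%:R * nr v + 1.
  have w0 : 0 < w by rewrite ltr_wpDl// mulr_ge0 ?nr_ge0.
  have [k kk kL] := LP (e / w) ltac:(by rewrite divr_gt0) (Num.truncn e^-1).
  exists k.
    rewrite -mulmxBr; apply: le_lt_trans (nr_mulmx _ _) _.
    move: kL; rewrite ltr_pdivlMr// => kL; apply: le_lt_trans kL; rewrite mulrC.
    by rewrite ler_wpM2l ?nr_ge0// lerDl.
  rewrite /r opprB addrC subrK -[ltRHS]invrK ltf_pV2 ?posrE ?invr_gt0//.
  apply: lt_le_trans (truncnS_gt _) _; by rewrite ler_nat ltnS ltnW// ltnS.
have nB k (w : Cn) : nr (w *m B k) <= n%:R * b1 * nr w.
  apply: le_trans (nr_mulmx _ _) _; rewrite mulrAC.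
  by rewrite ler_wpM2r ?nr_ge0// ler_wpM2l.
have nb0 : 0 <= n%:R * b1 by rewrite mulr_ge0.
have Linj (v : Cn) : nr v <= n%:R * b1 * nr (v *m L).
  apply/ler_addgt0Pr => e e0; have nb1 : 0 < n%:R * b1 + 1 by rewrite ltr_wpDl.
  have [k kv _] := LPv v (e / (n%:R * b1 + 1)) ltac:(by rewrite divr_gt0).
  have [ABk _ _] := AB k.
  rewrite -{1}[v]mulmx1 -ABk mulmxA; apply: le_trans (nB _ _) _.
  rewrite -[v *m A k](subrK (v *m L)).
  apply: le_trans (_ : n%:R * b1 * (nr (v *m A k - v *m L) + nr (v *m L)) <= _).
    by rewrite ler_wpM2l// nrD.
  rewrite mulrDr addrC lerD2l; move: kv; rewrite ltr_pdivlMr// => /ltW; apply: le_trans.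
  by rewrite mulrC ler_wpM2l ?nr_ge0// lerDl.
have Lu : L \in unitmx.
  rewrite -row_free_unit -kermx_eq0; apply/eqP/row_matrixP => i; rewrite row0.
  apply/eqP; rewrite -nr_eq0 eq_le nr_ge0 andbT.
  apply: le_trans (Linj _) _.
  have -> : row i (kermx L) *m L = 0 by rewrite -row_mul mulmx_ker row0.
  by rewrite nr0 mulr0.
have clL (v : Cn) : D1 v -> closure D2 (v *m L).
  move=> Dv; apply/closure_nr => e e0.
  have w0 : 0 < n%:R * nr v * a1 + 1 by rewrite ltr_wpDl// mulr_ge0// mulr_ge0 ?nr_ge0.
  have e3 : 0 < Num.min (e / 3) (e / 3 / (n%:R * nr v * a1 + 1)).
    by rewrite lt_min !divr_gt0.
  have [k] := LPv v _ e3; rewrite !lt_min => /andP[kv _] /andP[_ kr].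
  have [_ cl _] := AB k; have [y Dy yv] := (closure_nr _ _).1 (cl v Dv) (e / 3) ltac:(by rewrite divr_gt0).
  exists y => //.
  have h : nr ((r k)%:C%C *: (v *m A k) - v *m A k) <= e / 3.
    rewrite -[X in _ - X]scale1r -scalerBl -rmorphB nrZ nr_real distrC ger0_norm; last first.
      by rewrite subr_ge0; case/andP: (r01 k) => _ /ltW.
    move: kr; rewrite ltr_pdivlMr// => /ltW; apply: le_trans.
    have r10 : 0 <= 1 - r k by rewrite subr_ge0; case/andP: (r01 k) => _ /ltW.
    rewrite ler_wpM2l//; apply: le_trans (nr_mulmx _ _) _.
    by apply: le_trans (_ : n%:R * nr v * a1 <= _); rewrite ?lerDl// ler_wpM2l// mulr_ge0 ?nr_ge0.
  apply: le_lt_trans (nr_tri _ ((r k)%:C%C *: (v *m A k)) _) _.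
  have h2 := nr_tri ((r k)%:C%C *: (v *m A k)) (v *m A k) (v *m L).
  by move: yv kv h h2; move: (nr _) (nr _) (nr _) (nr _) => x1 x2 x3 x4; clear; lra.
have clB (w v : Cn) : D2 w -> w = v *m L -> closure D1 v.
  move=> Dw wv; apply/closure_nr => e e0.
  have w0 : 0 < n%:R * b1 * nr w + 1 by rewrite ltr_wpDl// mulr_ge0 ?nr_ge0.
  have nb1 : 0 < n%:R * b1 + 1 by rewrite ltr_wpDl.
  have e3 : 0 < Num.min (e / 3 / (n%:R * b1 + 1)) (e / 3 / (n%:R * b1 * nr w + 1)).
    by rewrite lt_min !divr_gt0.
  have [k] := LPv v _ e3; rewrite !lt_min => /andP[kv _] /andP[_ kr].
  have [ABk _ cl] := AB k; have [y Dy yv] := (closure_nr _ _).1 (cl w Dw) (e / 3) ltac:(by rewrite divr_gt0).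
  exists y => //.
  have h : nr ((r k)%:C%C *: (w *m B k) - w *m B k) <= e / 3.
    rewrite -[X in _ - X]scale1r -scalerBl -rmorphB nrZ nr_real distrC ger0_norm; last first.
      by rewrite subr_ge0; case/andP: (r01 k) => _ /ltW.
    move: kr; rewrite ltr_pdivlMr// => /ltW; apply: le_trans.
    have r10 : 0 <= 1 - r k by rewrite subr_ge0; case/andP: (r01 k) => _ /ltW.
    rewrite ler_wpM2l//; apply: le_trans (nB _ _) _.
    by rewrite lerDl.
  have h3 : nr (w *m B k - v) <= e / 3.
    (* [A k] is inverted exactly by [B k], so [v] differs from [w *m B k] only by the image under
       [B k] of the small vector [w - v *m A k]. *)
    have -> : w *m B k - v = (w - v *m A k) *m B k.
      by rewrite mulmxBl -mulmxA ABk mulmx1.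
    apply: le_trans (nB _ _) _; rewrite wv nrBC.
    move: kv; rewrite ltr_pdivlMr// => /ltW; apply: le_trans.
    by rewrite mulrC ler_wpM2l ?nr_ge0// lerDl.
  apply: le_lt_trans (nr_tri _ ((r k)%:C%C *: (w *m B k)) _) _.
  have h2 := nr_tri ((r k)%:C%C *: (w *m B k)) (w *m B k) v.
  by move: yv h h2 h3; move: (nr _) (nr _) (nr _) (nr _) => x1 x2 x3 x4; clear; lra.
exists L; apply: (inverse_pair_biholomorphic (g := mulmxr (invmx L))) => //; split=> x.
  move=> /(open_scale oD1)[s /andP[s0 s1] [x' Dx' ->]]; split.
  - rewrite /= -scalemxAl; apply: (closure_scale cD2 e20 De2); first by rewrite ltW.
    exact: clL.
  - exact: differentiable_mulmxr.
  - by rewrite /= -mulmxA mulmxV ?mulmx1.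
move=> /(open_scale oD2)[s /andP[s0 s1] [x' Dx' ->]]; split.
- rewrite /= -scalemxAl; apply: (closure_scale cD1 e10 De1); first by rewrite ltW.
  by apply: clB Dx' _; rewrite -mulmxA mulVmx ?mulmx1.
- exact: differentiable_mulmxr.
- by rewrite /= -mulmxA mulVmx ?mulmx1.
Qed.

Lemma balanced_ball D : open D -> D !=set0 -> balanced D ->
  exists2 e : R, 0 < e & forall x, nr x < e -> D x.
Proof.
move=> oD [x Dx] bD; have D0 : D 0.
  by have := bD x Dx 0; rewrite normr0 scale0r; apply; exact: ler01.
have [e e0 eP] := (open_nr D).1 oD _ D0; exists e => // y ye.
by apply: eP; rewrite subr0.
Qed.

End Limit.

Theorem theorem1p5 (R : realType) (n : nat)
    (D1 D2 U : set 'rV[R[i]]_n) (p : 'rV[R[i]]_n)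
    (F : 'rV[R[i]]_n -> 'rV[R[i]]_n)
    (hD1 : bounded_convex_balanced_domain D1)
    (hAut : ~ compact (Aut D1))
    (hp : boundary_orbit_accumulation_point D1 p)
    (hD2 : bounded_symmetric_domain_realization D2)
    (hU : open U) (hpU : U p)
    (hF : biholomorphic U (F @` U) F)
    (hFD : F @` (U `&` D1) `<=` D2)
    (hFbd : F @` (U `&` boundary D1) `<=` boundary D2)
    (hpeak : peak_point D1 p \/ peak_point D2 (F p)) :
  exists L : {linear 'rV[R[i]]_n -> 'rV[R[i]]_n}, biholomorphic D1 D2 L.
Proof.
have symD2 := realization_symmetry hD2.
case: hD1 => -[oD1 _ D1n] /bounded_set_nr[M1 _ DM1] /convex_set_convexr cD1 bD1.
case: hD2 => -[[oD2 _ D2n] /bounded_set_nr[M2 _ DM2] /convex_set_convexr cD2 bD2] _.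
have [e1 e10 De1] := balanced_ball oD1 D1n bD1.
have [e2 e20 De2] := balanced_ball oD2 D2n bD2.
have hom2 := homogeneous cD2 oD2 e20 De2 DM2 symD2.
have oV : open (F @` U) by case: hF => _ _ [g [[]]].
have [G FG] := biholomorphic_inverse_pair hF.
have [FP GP] := FG.
case: hp => -[clp _] [a [phi [autphi phip]]].
have acc e : 0 < e -> exists f g, inverse_pair D1 D1 f g /\ nr (f (set_val a) - p) < e.
  move=> e0; have nb := (near_nr p [set y | nr (y - p) < e]).2 (ex_intro2 _ _ e e0 (fun _ => id)).
  have nk : \forall k \near \oo, nr (set_val (phi k a) - p) < e by exact: (phip _ nb).
  have [k ke] := filter_ex nk; have [f [/biholomorphic_inverse_pair[g fg] phif]] := autphi k.
  by exists f, g; split => //; rewrite -phif.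
have D1a : D1 (set_val a) by exact: set_valP.
have near2 := preimage_near oD1 oD2 cD2 hU oV FG clp hpU hFD hFbd.
have [d2 d20 d2P] := near2.
have [d1 d10 dU] := (open_nr U).1 hU _ hpU.
have [VFp dFp GFp] := FP p hpU; have [_ dGp _] := GP _ VFp.
have cF := differentiable_nr dFp; have cG := differentiable_nr dGp; rewrite GFp in cG.
(* Whichever point is the peak point, the local inverse [G] or [F] itself makes the other one a
   local peak. *)
have [pk1 pk2] : local_peak D1 p /\ local_peak D2 (F p).
  case: hpeak => [/(peak_local_peak oD1 DM1) pk|/(peak_local_peak oD2 DM2) pk].
    split; first exact: pk.
    apply: (local_peak_transfer (a := G) (b := F) d20 pk _ cG cF) => z D2z zF.
    have [Vz D1Gz] := d2P z D2z zF; have [_ dG FGz] := GP _ Vz.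
    by split; [exact: D1Gz|exact: dG|exact: FGz].
  split; last exact: pk.
  apply: (local_peak_transfer (a := F) (b := G) d10 pk _ cF cG) => z D1z zp.
  have Uz := dU z zp; have [_ dF GFz] := FP _ Uz.
  by split; [apply: hFD; exists z|exact: dF|exact: GFz].
have app (r : R) (r01 : 0 < r < 1) := linear_approximation oD1 cD1 bD1 e10 De1 DM1 oD2 cD2 bD2
  e20 De2 DM2 pk1 pk2 hU hpU FG hFD near2 hom2 D1a acc r01.
have [L hL] := linear_limit oD1 cD1 e10 De1 DM1 oD2 cD2 e20 De2 DM2 app.
by exists (mulmxr L : {linear _ -> _}).
Qed.
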